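(* Suppose that $M$ is a compact and complete polynomial manifold. Then $Aff(M)_0$ is nilpotent.
   Context: A group $G$ of homeomorphisms of ${\bf R}^n$ acts freely and properly discontinuously if (i) for all $x\in{\bf R}^n$ and $\gamma\in G$, $\gamma(x)=x$ implies $\gamma=Id_{{\bf R}^n}$; and (ii) every $x\in{\bf R}^n$ has an open neighbourhood $U$ such that for $\gamma\in G$, $\gamma(U)\cap U\neq\emptyset$ implies $\gamma=Id_{{\bf R}^n}$. A compact and complete polynomial manifold of dimension $n$ is a compact differentiable manifold $M$ which is the quotient of ${\bf R}^n$ by a group of polynomial automorphisms of ${\bf R}^n$ acting freely and properly discontinuously on ${\bf R}^n$; let $p_M:{\bf R}^n\to M$ be the quotient (covering) map. A homeomorphism $\hat f$ of ${\bf R}^n$ is a lift of a homeomorphism $f$ of $M$ if $p_M\circ\hat f=f\circ p_M$. $Aff(M)$ is the group of homeomorphisms of $M$ having at least one lift which is an affine transformation of ${\bf R}^n$; it is endowed with the compact-open topology, and $Aff(M)_0$ is the connected component of the identity of $Aff(M)$. *)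

(* Defs.v *)
From HB Require Import structures.
From mathcomp Require Import all_boot all_order all_algebra.
From mathcomp Require Import all_classical all_reals.
From mathcomp Require Import topology normedtype.
(* [mpoly] is not imported: its notations clash with those of mathcomp-analysis. *)
From mathcomp Require mpoly.

Set Implicit Arguments.
Unset Strict Implicit.
Unset Printing Implicit Defensive.

Import Order.TTheory GRing.Theory Num.Theory.
Import numFieldNormedType.Exports.

Local Open Scope classical_set_scope.
Local Open Scope group_scope.

Section Nilpotent.
Variable gT : groupType.
Implicit Types H K S : set gT.

Definition subgroup H : Prop := group_closed [in H].

Definition generated S : set gT := smallest subgroup S.

Fixpoint lower_central H (k : nat) : set gT :=
  if k is k'.+1 then
    generated [set [~ x, y] | x in lower_central H k' & y in H]
  else H.

(* Meaningful when [H] is a subgroup. *)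
Definition is_nilpotent H : Prop := exists k, lower_central H k = [set 1].

Lemma subgroupP H :
  subgroup H <-> H 1 /\ (forall x y, H x -> H y -> H (x / y)).
Proof.
split=> [[H1 HV]|[H1 HV]]; split.
- by move: H1; rewrite inE.
- by move=> x y Hx Hy; move: (HV x y); rewrite !inE; apply.
- by rewrite inE.
- by move=> x y; rewrite !inE; apply: HV.
Qed.

End Nilpotent.

Record homeo (T : topologicalType) := Homeo {
  homeo_fun :> T -> T;
  homeo_inv : T -> T;
  homeo_funK : cancel homeo_fun homeo_inv;
  homeo_invK : cancel homeo_inv homeo_fun;
  homeo_fun_continuous : continuous homeo_fun;
  homeo_inv_continuous : continuous homeo_inv }.

HB.instance Definition _ (T : topologicalType) := gen_eqMixin (homeo T).
HB.instance Definition _ (T : topologicalType) := gen_choiceMixin (homeo T).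

Section HomeoGroup.
Variable T : topologicalType.
Implicit Types f g h : homeo T.

Lemma homeoP f g : f =1 g -> f = g.
Proof.
case: f g => [f f' fK f'K cf cf'] [g g' gK g'K cg cg'] /= /funext fg.
subst g; have f'g' : f' = g' by apply/funext => x; rewrite -[x in LHS]g'K fK.
by subst g'; f_equal; apply: Prop_irrelevance.
Qed.

Definition homeo_one : homeo T :=
  @Homeo T id id (fun=> erefl) (fun=> erefl) (fun=> cvg_id) (fun=> cvg_id).

Definition homeo_opp f : homeo T :=
  Homeo (@homeo_invK T f) (@homeo_funK T f)
    (@homeo_inv_continuous T f) (@homeo_fun_continuous T f).

Lemma homeo_comp_continuous f g : continuous (f \o g).
Proof.
by move=> x; apply: continuous_comp; apply: homeo_fun_continuous.
Qed.

Definition homeo_comp f g : homeo T :=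
  @Homeo T (f \o g) (homeo_inv g \o homeo_inv f)
    (can_comp (@homeo_funK T f) (@homeo_funK T g))
    (can_comp (@homeo_invK T g) (@homeo_invK T f))
    (@homeo_comp_continuous f g)
    (@homeo_comp_continuous (homeo_opp g) (homeo_opp f)).

Lemma homeo_compA : associative homeo_comp.
Proof. by move=> f g h; exact: homeoP. Qed.

Lemma homeo_comp1f : left_id homeo_one homeo_comp.
Proof. by move=> f; exact: homeoP. Qed.

Lemma homeo_compf1 : right_id homeo_one homeo_comp.
Proof. by move=> f; exact: homeoP. Qed.

Lemma homeo_compVf : left_inverse homeo_one homeo_opp homeo_comp.
Proof. by move=> f; apply: homeoP => x /=; rewrite homeo_funK. Qed.

Lemma homeo_compfV : right_inverse homeo_one homeo_opp homeo_comp.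
Proof. by move=> f; apply: homeoP => x /=; rewrite homeo_invK. Qed.

HB.instance Definition _ := isGroup.Build (homeo T)
  homeo_compA homeo_comp1f homeo_compf1 homeo_compVf homeo_compfV.

End HomeoGroup.

HB.instance Definition _ (T : topologicalType) := Topological.copy (homeo T)
  (initial_topology (@homeo_fun T : homeo T -> {compact-open, T -> T})).

Lemma homeo_mull_continuous (T : topologicalType) (h : homeo T) :
  continuous (fun f : homeo T => h * f).
Proof.
apply: (@continuous_comp_initial _ _ _
  (@homeo_fun T : homeo T -> {compact-open, T -> T})) => f.
apply/compact_open_cvgP; first by apply: fmap_filter; apply: nbhs_filter.
move=> K O cK oO /= hfKO.
have cf : continuous (@homeo_fun T : homeo T -> {compact-open, T -> T}).
  exact: initial_continuous.
have oO' : open (h @^-1` O).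
  by apply: open_comp => // x _; apply: homeo_fun_continuous.
have : nbhs f (@homeo_fun T @^-1` [set g : T -> T | g @` K `<=` h @^-1` O]).
  apply: cf; apply: open_nbhs_nbhs; split; first exact: compact_open_open.
  by move=> _ [x Kx <-]; apply: hfKO; exists x.
by apply: filterS => g gKO _ [x Kx <-]; apply: gKO; exists x.
Qed.

Lemma subgroup_connected_component (T : topologicalType) (H : set (homeo T)) :
  subgroup H -> subgroup (connected_component H 1).
Proof.
move=> /subgroupP[H1 HV].
have Hi f : H f -> H f^-1%g by move=> Hf; rewrite -div1g; apply: HV.
have HM f g : H f -> H g -> H (f * g)%g.
  by move=> Hf Hg; rewrite -[g]invgK; apply: HV => //; apply: Hi.
have C1 := connected_component_refl H1.
have CH := @connected_component_sub _ H 1.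
have CM f g : connected_component H 1 f -> connected_component H 1 g ->
    connected_component H 1 (f^-1 * g)%g.
  move=> Cf Cg.
  have sub : (fun k => f^-1 * k)%g @` connected_component H 1 `<=`
      connected_component H 1.
    apply: connected_component_max.
    - by exists f => //; rewrite mulVg.
    - by move=> _ [k Ck <-]; apply: HM; [apply: Hi|]; apply: CH.
    - apply: connected_continuous_connected (@component_connected _ _ _) _.
      by apply: continuous_subspaceT; apply: homeo_mull_continuous.
  by apply: sub; exists g.
have CV f : connected_component H 1 f -> connected_component H 1 f^-1%g.
  by move=> Cf; rewrite -[f^-1%g]mulg1; apply: CM.
by apply/subgroupP; split=> // f g Cf Cg; rewrite -[f]invgK; apply: CM; apply: CV.
Qed.

Section PolynomialManifold.
Variables (R : realType) (n : nat).
Local Notation V := 'rV[R]_n.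

Definition polynomial_map (f : V -> V) : Prop :=
  forall j, exists q : mpoly.mpoly n R,
    forall x, f x ord0 j = mpoly.meval (fun i => x ord0 i) q.

Definition polynomial_automorphism (g : homeo V) : Prop :=
  polynomial_map g /\ polynomial_map (g^-1)%g.

Definition affine_map (f : V -> V) : Prop :=
  exists (A : 'M[R]_n) (b : V), forall x, f x = (x *m A + b)%R.

Definition free_action (G : set (homeo V)) : Prop :=
  forall (x : V) (g : homeo V), G g -> g x = x -> g = 1.

Definition properly_discontinuous (G : set (homeo V)) : Prop :=
  forall x : V, exists U : set V, [/\ open U, U x &
    forall g : homeo V, G g -> (g @` U) `&` U !=set0 -> g = 1].

(* [p] exhibits the topological space [M] as the orbit space of [G]. *)
Definition quotient_map_by (G : set (homeo V)) (M : topologicalType)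
    (p : V -> M) : Prop :=
  [/\ set_surj setT setT p,
      forall x y, p x = p y <-> exists2 g, G g & g x = y
    & forall U : set M, open U <-> open (p @^-1` U)].

(* The orbit space of such a [G] is second countable and locally homeomorphic
   to [V] through [p]; the local inverses of [p] are charts whose changes of
   coordinates are restrictions of elements of [G], hence smooth, and this is
   the only smooth structure for which [p] is a local diffeomorphism.  So the
   smooth structure adds no data and no condition.  That a manifold is
   Hausdorff, however, does not follow from [free_action] and
   [properly_discontinuous], and is required explicitly. *)
Definition compact_complete_polynomial_manifold (G : set (homeo V))
    (M : topologicalType) (p : V -> M) : Prop :=
  [/\ subgroup G,
      G `<=` polynomial_automorphism,
      free_action G /\ properly_discontinuous G,
      quotient_map_by G p
    & compact [set: M] /\ hausdorff_space M].

Variables (M : topologicalType) (p : V -> M).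

Definition is_lift (fhat : homeo V) (f : homeo M) : Prop :=
  p \o fhat = f \o p.

Definition Aff : set (homeo M) :=
  [set f | exists2 fhat : homeo V, is_lift fhat f & affine_map fhat].

Definition Aff0 : set (homeo M) := connected_component Aff 1.

End PolynomialManifold.

Section Subgroups.
Variables (R : realType) (n : nat).
Local Notation V := 'rV[R]_n.

Lemma affine_map_div (f g : homeo V) :
  affine_map f -> affine_map g -> affine_map (f / g)%g.
Proof.
move=> [A [b fE]] [B [c gE]].
have gi y : g (g^-1%g y) = y by exact: homeo_invK.
have Binj (x : V) : (x *m B = 0 -> x = 0)%R.
  move=> xB0; apply: (can_inj (@homeo_funK _ g)).
  by rewrite !gE xB0 mul0mx.
have uB : B \in unitmx.
  rewrite -row_free_unit -kermx_eq0; apply/eqP/row_matrixP => i.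
  by rewrite row0; apply: Binj; rewrite -row_mul mulmx_ker row0.
exists (invmx B *m A)%R, (b - c *m invmx B *m A)%R => x.
rewrite -[LHS]/(f (g^-1%g x)) fE.
have -> : g^-1%g x = ((x - c) *m invmx B)%R.
  apply: (can_inj (@homeo_funK _ g)).
  by rewrite gi gE mulmxKV // subrK.
by rewrite !mulmxBl !mulmxA -addrA (addrC b).
Qed.

Lemma subgroup_Aff (M : topologicalType) (p : V -> M) : subgroup (Aff p).
Proof.
apply/subgroupP; split.
  by exists 1 => //; exists 1%:M%R, 0%R => x; rewrite mulmx1 addr0.
move=> f g [fh lf af] [gh lg ag]; exists (fh / gh); last exact: affine_map_div.
apply/funext => x /=; have := congr1 (@^~ (homeo_inv gh x)) lf; rewrite /= => ->.
congr (f _); apply: (can_inj (@homeo_funK _ g)); rewrite homeo_invK.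
by have := congr1 (@^~ (homeo_inv gh x)) lg; rewrite /= homeo_invK.
Qed.

Lemma subgroup_Aff0 (M : topologicalType) (p : V -> M) : subgroup (Aff0 p).
Proof. exact: subgroup_connected_component (subgroup_Aff p). Qed.

End Subgroups.

(* Main.v *)
(** Write [V] for the space of row vectors.  A nonempty convex [G]-invariant
    subset [F] of [V] is all of [V]: cocompactness yields a [G]-equivariant
    homotopy from the identity to a map into [F], which contradicts the
    Poincaré-Miranda theorem on a large cube when [F] misses a point.  Applied to
    the points with polynomial orbit under an affine map commuting with [G], this
    shows that such a map is unipotent; by Kolchin's argument the affine maps
    commuting with [G] therefore form a nilpotent group [N].

    A homeomorphism of [M] close to the identity lifts to one commuting with [G],
    hence so does every element of the connected group [Aff0 p].  These lifts need
    not be affine, but each is a deck transformation times an affine map, so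
    modulo [N] there are countably many of them.  A real function that is
    continuous on [Aff0 p] and invariant under [N] is thus constant.  Applied to
    the coordinates of commutators of lifts, this shows that commutators of
    elements of [Aff0 p] lift into [N], and that [Aff0 p] acts trivially on the
    successive quotients of a filtration of [N]. *)

Require Import Defs.
From mathcomp Require Import all_boot all_order all_algebra.
From mathcomp Require Import ring lra.
From mathcomp Require Import all_classical all_reals.
From mathcomp Require Import topology normedtype measure lebesgue_measure.
Import numFieldNormedType.Exports.

Set Implicit Arguments.
Unset Strict Implicit.
Unset Printing Implicit Defensive.

Import Order.TTheory GRing.Theory Num.Theory.

Local Open Scope classical_set_scope.
Local Open Scope ring_scope.

(** * The Poincaré-Miranda theorem *)

(** The obstacle is that [Aff0 p] comes without a Lie group structure: neither paths nor
    one-parameter subgroups are at hand, only connectedness. Moreover an element has affine lifts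
    and lifts commuting with [G], but possibly none that is both. What is canonical is conjugation.
    Two central lifts of [f] differ by a deck transformation, which commutes with every central [a],
    so [a ^ clift f] depends on [f] alone, varies continuously with [f], and is also the conjugate
    of [a] by an affine map. Every function to which the constancy argument is applied is built from
    such conjugates.

    These functions are not visibly invariant under the central affine maps: a change of lift by
    such a map [h] adds terms with a further factor of the form [affine_mx k - 1], with [k] central
    affine. Any [n.+1] such factors have product zero, so the functions are first multiplied by
    enough factors to become invariant, and the factors are then removed one at a time.

    Polynomiality of [G] enters through one fact: a polynomial map sends a sequence of points that
    is polynomial in the index to another such sequence. *)

Section CubicalSperner.
Variables (n p : nat).
Local Notation point := {ffun 'I_n -> 'I_p.+1}.
Variable u : 'I_n -> point -> 'F_2.

Implicit Types (z v w : point) (s L : seq 'I_n).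

Lemma addFF (x : 'F_2) : x + x = 0.
Proof. exact: (addrr_pchar2 (pchar_Fp (isT : prime 2))). Qed.

Lemma addF_eq0 (x y : 'F_2) : x + y = 0 -> x = y.
Proof. by move=> h; rewrite -[x]addr0 -(addFF y) addrA h add0r. Qed.

(* The value on the simplex [v :: vs] of the cup product of the coboundaries
   of the [u l], for [l] in [L]. *)
Fixpoint cup L v (vs : seq point) : 'F_2 :=
  match L, vs with
  | [::], [::] => 1
  | l :: L', w :: vs' => (u l v + u l w) * cup L' w vs'
  | _, _ => 0
  end.

Fixpoint del {T : Type} i (vs : seq T) : seq T :=
  match vs, i with
  | [::], _ => [::]
  | _ :: vs', 0%N => vs'
  | v :: vs', i'.+1 => v :: del i' vs'
  end.

(** A cup product of coboundaries is a cocycle. The isolated term is the face of [v :: w :: vs]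
    omitting [v]; the sum runs over the faces omitting one of the other vertices. *)
Lemma cup_closed L v w vs : size vs = size L ->
  cup L w vs + \sum_(i < (size vs).+1) cup L v (del i (w :: vs)) = 0.
Proof.
elim: L v w vs => [|l L IH] v w [|x vs] //=.
  by rewrite big_ord_recl big_ord0 /= addr0 addFF.
case=> sz; rewrite big_ord_recl /=.
under eq_bigr do rewrite /=.
rewrite -big_distrr /=.
have /addF_eq0 <- := IH w x vs sz.
set a := u l v; set b := u l w; set c := u l x; set d := cup L x vs.
transitivity ((a + b + c) * d + (a + b + c) * d); last exact: addFF.
by ring.
Qed.

Lemma cup_const L v vs j a : j \in L ->
  (forall w, w \in v :: vs -> u j w = a) -> cup L v vs = 0.
Proof.
elim: L v vs => // l L IH v [|w vs] //=; rewrite inE => /orP[/eqP<-|jL] h.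
  by rewrite !h ?inE ?eqxx ?orbT // addFF mul0r.
by rewrite (IH w) ?mulr0 // => x xw; apply: h; rewrite inE xw orbT.
Qed.

Lemma cup_neq0 L v vs j : j \in L -> cup L v vs != 0 ->
  (exists2 w, w \in v :: vs & u j w = 0) /\
  (exists2 w, w \in v :: vs & u j w != 0).
Proof.
move=> jL c0; case: (boolP (all (fun w => u j w == u j v) (v :: vs))).
  move=> /allP h; move: c0; rewrite (cup_const (a := u j v) jL) ?eqxx //.
  by move=> w /h /eqP.
rewrite -has_predC => /hasP[w wv /= uw].
have [uv0|uv0] := eqVneq (u j v) 0.
  by split; [exists v; rewrite ?inE ?eqxx|exists w; rewrite // -uv0].
split; last by exists v; rewrite ?inE ?eqxx.
exists w => //; apply: contra_neq_eq uw => uw0.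
have F2 (x : 'F_2) : x != 0 -> x = 1.
  by case: x => [[|[|x]] h] // _; apply: val_inj.
by rewrite (F2 _ uw0) (F2 _ uv0).
Qed.

(** When [z j] is already [p], [inord] falls back to [0]; the walks summed below start in cells
    where this does not occur. *)
Definition step z j : point := [ffun i => if i == j then inord (z i).+1 else z i].

Lemma stepC z i j : step (step z i) j = step (step z j) i.
Proof.
by apply/ffunP => k; rewrite !ffunE; case: eqP => // ->; case: eqP.
Qed.

(** With [z] prepended and [s] running over permutations, these are the simplices of Kuhn's
    triangulation of the unit cube with lower corner [z]. *)
Definition walk z s : seq point := scanl step z s.

Fixpoint swap {T : Type} i (s : seq T) : seq T :=
  match s, i with
  | x :: y :: s', 0%N => y :: x :: s'
  | x :: s', i'.+1 => x :: swap i' s'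
  | _, _ => s
  end.

Lemma swapK {T : Type} i : involutive (@swap T i).
Proof.
elim: i => [|i IH] [|x [|y s]] //=; first by case: i {IH}.
by case: (swap i (y :: s)) (IH (y :: s)) => [|z [|w t]] ->.
Qed.

Lemma perm_swap i s : perm_eq (swap i s) s.
Proof.
elim: i s => [|i IH] [|x [|y s]] //=; last by rewrite perm_cons IH.
  by rewrite -[y :: x :: s]/([:: y] ++ [:: x] ++ s) perm_catCA.
by case: i {IH}.
Qed.

Lemma nth_swap x0 i s : (i.+1 < size s)%N ->
  (nth x0 (swap i s) i = nth x0 s i.+1) /\ (nth x0 (swap i s) i.+1 = nth x0 s i).
Proof. by elim: i s => [|i IH] [|x [|y s]] //= h; apply: (IH (y :: s)). Qed.

(** Exchanging two consecutive directions moves only the vertex reached between them, so both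
    simplices share the face opposite to it. *)
Lemma del_swap i z s : (i.+1 < size s)%N ->
  del i (walk z (swap i s)) = del i (walk z s).
Proof.
elim: i z s => [|i IH] z [|x [|y s]] //= h; first by rewrite stepC.
by rewrite -[swap i (y :: s)]/(swap i (y :: s)) /walk /= (IH _ (y :: s)).
Qed.

(** As [s0] has no repetition, the swap is an involution of its permutations without fixed points;
    paired terms are equal and cancel in characteristic 2. *)
Lemma swap_sum0 (F : seq 'I_n -> 'F_2) i s0 : uniq s0 -> (i.+1 < size s0)%N ->
  (forall s, size s = size s0 -> F (swap i s) = F s) ->
  \sum_(s <- permutations s0) F s = 0.
Proof.
case: s0 => // x0 t us lt_i FE; set s0 := x0 :: t in us lt_i FE *.
pose a s := (nth x0 s i < nth x0 s i.+1)%N.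
rewrite (bigID a) /=; set A := \sum_(_ <- _ | a _) _.
suff -> : \sum_(s <- permutations s0 | ~~ a s) F s = A by apply: addFF.
have P : perm_eq (permutations s0) [seq swap i s | s <- permutations s0].
  apply: uniq_perm; rewrite ?permutations_uniq //.
    by rewrite map_inj_uniq ?permutations_uniq //; apply: can_inj (@swapK _ i).
  move=> s; rewrite mem_permutations; apply/idP/mapP => [ps|[s' ps' ->]].
    exists (swap i s); last by rewrite swapK.
    by rewrite mem_permutations (perm_trans (perm_swap _ _)).
  by rewrite (perm_trans (perm_swap _ _)) // -mem_permutations.
rewrite (perm_big _ P) big_map /A big_seq_cond [RHS]big_seq_cond.
apply: eq_big => [s|s /andP[]]; last first.
  by rewrite mem_permutations => /perm_size /FE.
case sP : (s \in _) => //=; move: sP; rewrite mem_permutations => ps.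
have szs : (i.+1 < size s)%N by rewrite (perm_size ps).
rewrite /a; have [-> ->] := nth_swap x0 szs; rewrite -leqNgt leq_eqVlt.
case: eqP => //= /val_inj/eqP; rewrite nth_uniq // ?(perm_uniq ps) //; last exact: ltnW.
by rewrite (ltn_eqF (ltnSn i)).
Qed.

Hypothesis p_gt0 : (0 < p)%N.
Hypothesis u_bot : forall i z, z i = 0%N :> nat -> u i z = 0.
Hypothesis u_top : forall i z, z i = p :> nat -> u i z = 1.

(** Lower corners of the unit cubes in the face of the grid whose coordinates outside [L] are [p].
    Only upper faces occur, because [u_bot] kills the boundary terms on the lower ones. *)
Definition cell L z := [forall i, if i \in L then (z i < p)%N else z i == p :> nat].

Definition cup_sum L :=
  \sum_(s <- permutations L) \sum_(z | cell L z) cup L z (walk z s).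

Lemma walk_coord z s i w : i \notin s -> w \in z :: walk z s -> w i = z i.
Proof.
elim: s z => [|j s IH] z /=; first by rewrite inE => _ /eqP->.
rewrite !inE negb_or => /andP[ij si] /predU1P[->//|] /(IH _ si) ->.
by rewrite ffunE (negbTE ij).
Qed.

Lemma sum_permutations (F : seq 'I_n -> 'F_2) s0 : uniq s0 -> s0 != [::] ->
  \sum_(s <- permutations s0) F s =
  \sum_(j <- s0) \sum_(s <- permutations (rem j s0)) F (j :: s).
Proof.
move=> us nz; rewrite (perm_big _ (permutationsE _)) ?lt0n ?size_eq0 //.
by rewrite big_allpairs_dep undup_id.
Qed.

Lemma perm_permutations_rot s0 :
  perm_eq (permutations s0) [seq rot 1 s | s <- permutations s0].
Proof.
apply: uniq_perm; rewrite ?permutations_uniq //.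
  by rewrite map_inj_uniq ?permutations_uniq //; apply: rot_inj.
move=> s; rewrite mem_permutations; apply/idP/mapP => [ps|[s' ps' ->]].
  by exists (rotr 1 s); rewrite ?rotrK // mem_permutations perm_rotr.
by rewrite perm_rot -mem_permutations.
Qed.

Lemma reindex_step L j (B : point -> 'F_2) : j \in L ->
  \sum_(z | cell L z) B (step z j) =
  \sum_(w : point | [&& (0 < w j)%N & [forall i, if i == j then true else
      if i \in L then (w i < p)%N else w i == p :> nat]]) B w.
Proof.
move=> jL.
pose pre w : point := [ffun i => if i == j then inord (w i).-1 else w i].
rewrite (reindex_onto (fun w => pre w) (fun z => step z j)) /=; last first.
  move=> z /forallP/(_ j); rewrite jL => zj; apply/ffunP => i; rewrite !ffunE.
  by case: eqP => // ->; apply: val_inj; rewrite !(inordK, ltnS) //= ?ltnW // inordK.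
have stepK w : (0 < w j)%N -> step (pre w) j = w.
  move=> wj; apply/ffunP => i; rewrite !ffunE.
  case: eqP => // ->; apply: val_inj => /=.
  have h : ((w j).-1 < p.+1)%N by apply: leq_trans (ltn_ord (w j)); rewrite ltnS leq_pred.
  by rewrite inordK inordK // prednK.
apply: eq_big => [w|w /andP[_ /eqP ->] //].
apply/andP/andP => [[/forallP c /eqP e]|[wj /forallP c]]; split.
- rewrite -e ffunE eqxx inordK //.
  by have := c j; rewrite jL => h; rewrite ltnS.
- by apply/forallP => i; have := c i; rewrite ffunE; case: (i =P j).
- apply/forallP => i; have := c i; rewrite ffunE; case: (i =P j) => [->|//] _.
  rewrite jL inordK; last by apply: leq_trans (ltn_ord (w j)); rewrite ltnS leq_pred.
  by rewrite prednK // -ltnS.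
- by rewrite stepK.
Qed.

Lemma del_last_walk z j s : del (size s) (walk z (rcons s j)) = walk z s.
Proof. by elim: s z => //= k s IH z; rewrite /walk /= IH. Qed.

(* Stokes: writing the cup product as the coboundary of [u l] times a cocycle,
   the faces omitting a middle vertex cancel in pairs, and those omitting an end
   vertex cancel too unless they lie in the boundary of the cube. *)
Lemma cup_sum_cons l L : uniq (l :: L) -> cup_sum (l :: L) = cup_sum L.
Proof.
move=> uL; set L' := l :: L.
pose B s w := u l w * cup L w (walk w s).
pose F m s := \sum_(z | cell L' z) u l z * cup L z (del m (walk z s)).
have szL s : s \in permutations L' -> size s = (size L).+1.
  by rewrite mem_permutations => /perm_size.
(* By [cup_closed] the face omitting [z] is the sum of the other faces; those omitting a middle
   vertex cancel by [swap_sum0], which leaves the face omitting the last vertex. *)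
have Fsum : \sum_(s <- permutations L')
    \sum_(z | cell L' z) u l z * cup L (step z (head l s)) (behead (walk z s)) =
    \sum_(s <- permutations L') F (size L) s.
  have -> : \sum_(s <- permutations L') F (size L) s =
            \sum_(m < (size L).+1) \sum_(s <- permutations L') F m s.
    rewrite big_ord_recr /= [X in _ = X + _]big1 ?add0r // => i _.
    apply: (@swap_sum0 _ i) => //; first by rewrite /= ltnS.
    move=> s szs; apply: eq_bigr => z _; rewrite del_swap // szs /= ltnS //.
  rewrite [RHS]exchange_big /=; apply: eq_big_seq => s /szL szs.
  rewrite [RHS]exchange_big /=; apply: eq_bigr => z _; rewrite -mulr_sumr; congr (_ * _).
  case: s szs => // j s [szs] /=; apply: addF_eq0.
  by rewrite -szs -(size_scanl step (step z j) s) cup_closed // size_scanl.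
rewrite /cup_sum -/L'.
have -> : \sum_(s <- permutations L') \sum_(z | cell L' z) cup L' z (walk z s) =
    \sum_(j <- L') \sum_(s <- permutations (rem j L')) 
      (\sum_(z | cell L' z) B s (step z j) + \sum_(z | cell L' z) B s z).
  transitivity (\sum_(s <- permutations L')
      (\sum_(z | cell L' z) u l (step z (head l s)) * cup L (step z (head l s)) (behead (walk z s)))
     + \sum_(s <- permutations L') \sum_(z | cell L' z)
          u l z * cup L (step z (head l s)) (behead (walk z s))).
    rewrite -[RHS]big_split /=; apply: eq_big_seq => s /szL szs.
    rewrite -[RHS]big_split /=; apply: eq_bigr => z _.
    by case: s szs => // j s _ /=; rewrite addrC mulrDl.
  rewrite Fsum.
  (* Rotation moves the first direction [j] to the end. The face omitting the last vertex becomes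
     the walk along [s] from [z], opposite to the same walk from [step z j]. *)
  have -> : \sum_(s <- permutations L') F (size L) s =
            \sum_(s <- permutations L') F (size L) (rot 1 s).
    by rewrite [LHS](perm_big _ (perm_permutations_rot _)) big_map.
  rewrite -[LHS]big_split /=.
  have ne : L' != [::] by [].
  rewrite (sum_permutations _ uL ne); apply: eq_big_seq => j jL.
  apply: eq_big_seq => s; rewrite mem_permutations => ps.
  have szs : size s = size L by rewrite (perm_size ps) size_rem.
  congr (_ + _); apply: eq_bigr => z _.
  by rewrite rot1_cons -szs del_last_walk.
(* Summed along direction [j], opposite faces telescope to [w j = p] and [w j = 0]. For [j = l] the
   label is 1 on the first and 0 on the second; for [j != l] the label [u j] is constant on each, so
   [cup_const] applies. *)
have term j s : j \in L' -> s \in permutations (rem j L') ->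
    \sum_(z | cell L' z) B s (step z j) + \sum_(z | cell L' z) B s z =
    if j == l then \sum_(z | cell L z) cup L z (walk z s) else 0.
  move=> jL; rewrite mem_permutations => ps; rewrite (reindex_step _ jL).
  have js : j \notin s by rewrite (perm_mem ps) mem_rem_uniqF.
  pose Q w := [forall i, if i == j then true else
    if i \in L' then (w i < p)%N else w i == p :> nat].
  have cellE z : cell L' z = (z j < p)%N && Q z.
    apply/forallP/andP => [c|[zj /forallP c] i].
      split; first by have := c j; rewrite jL.
      by apply/forallP => i; case: eqP => // _; apply: c.
    by have := c i; case: (i =P j) => [->|//]; rewrite jL.
  rewrite [X in _ + X](eq_bigl _ _ cellE) -/(Q _).
  have cellQ w : j = l -> cell L w = (w j == p :> nat) && Q w.
    move=> jl; apply/forallP/andP => [c|[wj /forallP c] i].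
      split; first by have := c j; rewrite jl (negbTE (andP uL).1).
      apply/forallP => i; case: eqP => // /eqP ij; have := c i.
      by rewrite inE -jl (negbTE ij).
    have := c i; case: (i =P j) => [->|/eqP ij]; last by rewrite inE -jl (negbTE ij).
    by rewrite jl (negbTE (andP uL).1) -jl.
  rewrite !big_mkcondl -big_split /=.
  case: (j =P l) => [jl|/eqP jl].
    rewrite (eq_bigl _ _ (fun w => cellQ w jl)) big_mkcondl.
    apply: eq_bigr => w _; rewrite {}/B -jl.
    have := ltn_ord (w j); rewrite ltnS leq_eqVlt => /orP[/eqP wp|wp].
      by rewrite wp p_gt0 ltnn eqxx addr0 u_top // mul1r.
    rewrite wp (ltn_eqF wp); case: (posnP (w j)) => w0; last exact: addFF.
    by rewrite u_bot // mul0r addr0.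
  rewrite big1 // => w _.
  have jL' : j \in L by move: jL; rewrite inE (negbTE jl).
  have B0 a : u j w = a -> (forall z, z j = w j -> u j z = a) -> B s w = 0.
    move=> _ h; rewrite /B (cup_const (a := a) jL') ?mulr0 // => x xw.
    by apply: h; apply: walk_coord xw.
  have := ltn_ord (w j); rewrite ltnS leq_eqVlt => /orP[/eqP wp|wp].
    rewrite (B0 1) ?u_top ?if_same ?addr0 // => z e.
    by rewrite u_top // e.
  case: (posnP (w j)) => w0; last by rewrite wp; exact: addFF.
  by rewrite (B0 0) ?u_bot ?if_same ?addr0 // => z e; rewrite u_bot // e.
rewrite (eq_big_seq (fun j => if j == l then cup_sum L else 0)); last first.
  move=> j jL; rewrite (eq_big_seq _ (fun s => term j s jL)).
  case: eqP => [->|_]; last by rewrite big1.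
  by rewrite /= eqxx.
rewrite big_cons eqxx big1_seq ?addr0 // => j /andP[_ jL].
by case: eqP => // jl; move: uL; rewrite /= -jl jL.
Qed.

Lemma cup_sum1 L : uniq L -> cup_sum L = 1.
Proof.
elim: L => [_|l L IH uL]; last by rewrite cup_sum_cons // IH //; case/andP: uL.
rewrite /cup_sum (perm_big [:: [::]]) ?big_seq1 /=; last first.
  by apply: uniq_perm; rewrite ?permutations_uniq // => s;
    rewrite mem_permutations inE perm_sym -size_eq0;
    apply/idP/idP => [/perm_size <-|/eqP/size0nil->].
rewrite (big_pred1 [ffun=> ord_max]) // => z; apply/forallP/eqP => [c|-> i].
  by apply/ffunP => i; rewrite ffunE; apply: val_inj; apply/eqP; apply: c.
by rewrite ffunE.
Qed.

Lemma walk_box s z w : uniq s -> w \in z :: walk z s ->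
  (forall j, j \in s -> (z j < p)%N) ->
  forall i, (z i <= w i <= (z i).+1)%N.
Proof.
elim: s z => [|j s IH] z /=; first by rewrite inE => _ /eqP-> _ i; rewrite leqnn leqnSn.
move=> /andP[js us]; rewrite inE => /predU1P[->|ws] zp i; first by rewrite leqnn leqnSn.
have zj : (z j < p)%N by apply: zp; rewrite inE eqxx.
have [->|ij] := eqVneq i j.
  rewrite (walk_coord js ws) ffunE eqxx inordK ?ltnS //.
  by rewrite leqnn leqnSn.
have := IH (step z j) us ws _ i; rewrite ffunE (negbTE ij); apply.
move=> k ks; rewrite ffunE ifN ?zp ?inE ?ks ?orbT //.
by apply: contraNneq js => <-.
Qed.

(** The cup products over the whole cube sum to 1, so one simplex has a nonzero term; on it no label
    is constant, by [cup_neq0]. *)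
Lemma discrete_miranda : exists2 z : point, (forall i, (z i < p)%N) &
  forall i, (exists2 v : point, (forall k, (z k <= v k <= (z k).+1)%N) & u i v = 0) /\
            (exists2 v : point, (forall k, (z k <= v k <= (z k).+1)%N) & u i v != 0).
Proof.
have uE : uniq (enum 'I_n) by apply: enum_uniq.
have := cup_sum1 uE; rewrite /cup_sum => S1.
have [s sP [z cz c0]] : exists2 s, s \in permutations (enum 'I_n) &
    exists2 z, cell (enum 'I_n) z & cup (enum 'I_n) z (walk z s) != 0.
  apply: contrapT => h; move: S1; rewrite big1_seq; first by move/esym/eqP; rewrite oner_eq0.
  move=> s /andP[_ sP]; rewrite big1 // => z cz; apply/eqP; apply: contrapT => /negP c0.
  by apply: h; exists s => //; exists z.
have zp i : (z i < p)%N by have /forallP/(_ i) := cz; rewrite mem_enum.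
exists z => // i; have us : uniq s by rewrite (perm_uniq (_ : perm_eq s (enum 'I_n))) // -mem_permutations.
have [] := cup_neq0 (mem_enum _ i) c0; last move=> [v vs uv] [w ws uw].
by split; [exists v|exists w] => //; apply: (@walk_box s) => // j _; apply: zp.
Qed.
End CubicalSperner.

Section RowNorm.
Variables (R : realType) (n : nat).
Implicit Types x y : 'rV[R]_n.

Lemma norm_coord x i : `|x ord0 i| <= `|x|.
Proof.
by rewrite [leRHS]mx_normrE; apply: (le_bigmax _ (fun ij => `|x ij.1 ij.2|) (ord0, i)).
Qed.

Lemma norm_row_le x e : 0 <= e -> (forall i, `|x ord0 i| <= e) -> `|x| <= e.
Proof.
move=> e0 h; rewrite [leLHS]mx_normrE; apply/bigmax_leP; split=> // -[a b] _ /=.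
by rewrite (ord1 a).
Qed.

Lemma compact_cball x (a : R) : compact [set y : 'rV[R]_n | `|x - y| <= a].
Proof.
apply: bounded_closed_compact; last exact: (@closed_closed_ball_ R 'rV[R]_n x a).
exists (`|x| + a); split; first exact: num_real.
move=> b ab y /= xa; apply: le_trans (ltW ab).
have -> : y = x - (x - y) by rewrite opprB addrC subrK.
by apply: le_trans (ler_normB _ _) _; rewrite lerD2l.
Qed.

End RowNorm.

(** The labels record whether each coordinate of [f] is positive at the points of a grid with mesh
    [2 * a / p.+1]. Near a cluster point of the boxes found by [discrete_miranda], every coordinate
    takes both signs. *)
Lemma poincare_miranda (R : realType) n (f : 'rV[R]_n -> 'rV[R]_n) (a : R) :
  0 < a -> continuous f ->
  (forall (x : 'rV[R]_n) i, `|x| <= a -> x ord0 i = - a -> f x ord0 i <= 0) ->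
  (forall (x : 'rV[R]_n) i, `|x| <= a -> x ord0 i = a -> 0 < f x ord0 i) ->
  exists2 x, `|x| <= a & f x = 0.
Proof.
move=> a0 cf fbot ftop.
pose gp p (z : {ffun 'I_n -> 'I_p.+1}) : 'rV[R]_n :=
  \row_i (- a + 2 * a * (z i)%:R / p%:R).
have gpa p (z : {ffun 'I_n -> 'I_p.+2}) : `|gp _ z| <= a.
  apply: norm_row_le => [|i]; first exact: ltW.
  rewrite mxE ler_norml.
  have h0 : 0 <= (z i)%:R / p.+1%:R :> R by rewrite divr_ge0.
  have h1 : (z i)%:R / p.+1%:R <= 1 :> R.
    by rewrite ler_pdivrMr ?ltr0n // mul1r ler_nat -ltnS.
  move: h0 h1; rewrite -mulrA; set t := _ / _ => h0 h1.
  have := mulr_ge0 (ltW a0) h0; have := ler_wpM2l (ltW a0) h1.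
  by rewrite mulr1 => *; apply/andP; split; lra.
have step p : exists y : 'rV[R]_n, `|y| <= a /\ forall i,
    (exists2 v, `|v - y| <= 2 * a / p.+1%:R & f v ord0 i <= 0) /\
    (exists2 v, `|v - y| <= 2 * a / p.+1%:R & 0 < f v ord0 i).
  pose u i (z : {ffun 'I_n -> 'I_p.+2}) : 'F_2 := (0 < f (gp _ z) ord0 i)%R%:R.
  have [i z zi|i z zi|z zp h] := @discrete_miranda n p.+1 u isT.
  - rewrite /u ltNge (fbot _ i (gpa _ z)) //.
    by rewrite mxE zi mulr0 mul0r addr0.
  - rewrite /u (ftop _ i (gpa _ z)) //.
    by rewrite mxE zi mulfK ?pnatr_eq0 //; ring.
  have close (v : {ffun 'I_n -> 'I_p.+2}) : (forall k, (z k <= v k <= (z k).+1)%N) ->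
      `|gp _ v - gp _ z| <= 2 * a / p.+1%:R.
    move=> vz; have d0 : 0 <= 2 * a / p.+1%:R by rewrite divr_ge0 // mulr_ge0 // ltW.
    apply: norm_row_le => // i; rewrite !mxE.
    have -> : - a + 2 * a * (v i)%:R / p.+1%:R - (- a + 2 * a * (z i)%:R / p.+1%:R) =
       (2 * a / p.+1%:R) * ((v i)%:R - (z i)%:R) by ring.
    have /andP[v1 v2] := vz i; rewrite normrM ger0_norm // -[leRHS]mulr1 ler_wpM2l //.
    by rewrite ger0_norm ?subr_ge0 ?ler_nat // lerBlDr -[1]/(1%:R) -natrD ler_nat add1n.
  exists (gp _ z); split=> [|i]; first exact: gpa.
  have [[v vz v0] [w wz w0]] := h i; split.
    exists (gp _ v); first exact: close.
    move: v0; rewrite /u; case: (ltP 0 (f (gp _ v) ord0 i)) => // _ /eqP.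
  exists (gp _ w); first exact: close.
  by move: w0; rewrite /u; case: (ltP 0 (f (gp _ w) ord0 i)) => // _; rewrite eqxx.
have [y hy] := choice step.
have := @compact_cball R n 0 a (y @ \oo) _ _.
case.
  by exists 0%N => // p _; have [] := hy p; rewrite /= sub0r normrN.
move=> x [/=]; rewrite sub0r normrN => xa cx; exists x => //.
have near_x (Q : 'rV[R]_n -> Prop) : (\forall v \near x, Q v) -> exists p,
   forall v, `|v - y p| <= 2 * a / p.+1%:R -> Q v.
  move=> /nbhs_ballP[e /= e0 Qe].
  have e20 : 0 < e / 2 by rewrite divr_gt0.
  have [N /(_ _) Np] : exists N, forall p, (N <= p)%N -> 2 * a / p.+1%:R < e / 2.
    have : 0 <= 2 * a / (e / 2) by apply: divr_ge0; [apply: mulr_ge0|]; rewrite // ltW.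
    move=> /archi_boundP; set N := Num.bound _ => hN; exists N => p Np.
    rewrite ltr_pdivrMr ?ltr0n // [ltRHS]mulrC -ltr_pdivrMr //; apply: lt_le_trans hN _.
    by rewrite ler_nat (leq_trans Np).
  have := cx [set v | exists2 p, (N <= p)%N & v = y p] (ball x (e / 2)).
  case.
  - by exists N => // p /= Np'; exists p.
  - exact: nbhsx_ballx.
  move=> _ [[p pN ->] xy]; exists p => v vy; apply: Qe.
  rewrite -ball_normE /= in xy *.
  have -> : x - v = (x - y p) - (v - y p) by rewrite opprB addrA subrK.
  apply: le_lt_trans (ler_normB _ _) _; rewrite (splitr e) ltrD //.
  exact: le_lt_trans vy (Np _ pN).
have cfi i : continuous (fun v => f v ord0 i).
  by move=> v; apply: (@continuous_comp _ _ _ f (fun w : 'rV[R]_n => w ord0 i)); [exact: cf|exact: coord_continuous].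
apply/rowP => i; rewrite mxE; apply/eqP; rewrite eq_le; apply/andP; split.
- rewrite leNgt; apply/negP => fx.
  have [p hp] := near_x (fun v => 0 < f v ord0 i) (cfi i x _ (lt_nbhsr fx)).
  have [[v vz v0] _] := (hy p).2 i.
  by have := hp _ vz; rewrite ltNge v0.
- rewrite leNgt; apply/negP => fx.
  have [p hp] := near_x (fun v => f v ord0 i < 0) (cfi i x _ (lt_nbhsl fx)).
  have [_ [v vz v0]] := (hy p).2 i.
  by have := hp _ vz; rewrite ltNge (ltW v0).

Qed.

(** * Deck transformations and invariant convex sets *)

Section HomeoFacts.
Variable T : topologicalType.
Implicit Types f g : homeo T.
Lemma homeo1E x : (1 : homeo T)%g x = x. Proof. by []. Qed.
Lemma homeoME f g x : (f * g)%g x = f (g x). Proof. by []. Qed.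
Lemma homeoK f : cancel f (f^-1)%g. Proof. exact: homeo_funK. Qed.
Lemma homeoVK f : cancel (f^-1)%g f. Proof. exact: homeo_invK. Qed.
Lemma homeo_cts f : continuous f. Proof. exact: homeo_fun_continuous. Qed.
End HomeoFacts.

Lemma cvg_near_eq (T U : topologicalType) (f g : T -> U) x :
  {for x, continuous g} -> (\forall y \near x, f y = g y) -> {for x, continuous f}.
Proof.
move=> cg fg; rewrite /prop_for /continuous_at (nbhs_singleton fg).
apply: cvg_trans cg; apply: near_eq_cvg.
by apply: filterS fg.
Qed.

Lemma row_ball_open (R : realType) n (x : 'rV[R]_n) (r : R) : open (ball x r).
Proof. exact: (@ball_open R 'rV[R]_n x r). Qed.

(** The filter of all large enough finite lists: combined with [compact_near_coveringP], it turns
    local finiteness into finiteness over a compact set. *)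
Lemma seq_inclusion_filter (J : eqType) :
  Filter (filter_from setT (fun s : seq J => [set t : seq J | {subset s <= t}])).
Proof.
apply: filter_from_filter; first by exists [::].
move=> s t _ _; exists (s ++ t) => // u stu; split=> x xs; apply: stu.
  by rewrite mem_cat xs.
by rewrite mem_cat xs orbT.
Qed.

Lemma compact_finite (T : topologicalType) (J : eqType) (K : set T)
    (P : T -> J -> Prop) : compact K ->
  (forall x, K x -> exists s : seq J, \forall y \near x, forall j, P y j -> j \in s) ->
  exists s : seq J, forall y j, K y -> P y j -> j \in s.
Proof.
move=> cK loc.
have [|s _ /(_ s (fun x => id)) hs] := (compact_near_coveringP K).1 cK _ _
  (fun (s : seq J) y => forall j, P y j -> j \in s) (@seq_inclusion_filter J).
  move=> x /loc[s hs].
  exists ([set y | forall j, P y j -> j \in s], [set t : seq J | {subset s <= t}]).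
    by split=> //; exists s.
  by case=> y t /= [ys st] j /ys /st.
by exists s => y j Ky; exact: hs.
Qed.

Lemma compact_norm_bound (R : realType) n (A : set 'rV[R]_n) :
  compact A -> exists a : R, forall v, A v -> `|v| <= a.
Proof.
move=> /compact_bounded[a [_ ha]]; exists (a + 1) => v; apply: ha.
by rewrite ltrDl.
Qed.

Lemma seq_compact_bound (R : realType) n (T : eqType) (s : seq T) (f : T -> set 'rV[R]_n) :
  (forall i, compact (f i)) ->
  exists a : R, forall i v, i \in s -> f i v -> `|v| <= a.
Proof.
move=> cf; elim: s => [|j s [a ha]]; first by exists 0.
have [b hb] := compact_norm_bound (cf j); exists (Order.max a b) => i v.
rewrite inE le_max => /predU1P[->|si] fi; first by rewrite (hb _ fi) orbT.
by rewrite (ha _ _ si fi).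
Qed.

Section Action.
Variables (R : realType) (n : nat) (G : set (homeo 'rV[R]_n)).
Variables (M : topologicalType) (p : 'rV[R]_n -> M).
Local Notation V := 'rV[R]_n.
Hypothesis HM : compact_complete_polynomial_manifold G p.
Implicit Types (g h : homeo V) (x y v w : V).

Lemma deck1 : G 1%g.
Proof. by have [/subgroupP[]] := HM. Qed.

Lemma deck_div g h : G g -> G h -> G (g / h)%g.
Proof. by have [/subgroupP[_ H] _ _ _ _] := HM; apply: H. Qed.

Lemma deckV g : G g -> G (g^-1)%g.
Proof. by move=> Gg; rewrite -[(g^-1)%g]mul1g; apply: deck_div => //; exact: deck1. Qed.

Lemma deckM g h : G g -> G h -> G (g * h)%g.
Proof. by move=> Gg Gh; rewrite -[h]invgK; apply: deck_div => //; exact: deckV. Qed.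

Lemma deck_poly g : G g -> polynomial_map g.
Proof. by have [_ H _ _ _] := HM; move=> /H[]. Qed.

Lemma proj_surj (m : M) : exists v, p v = m.
Proof. by have [_ _ _ [s _ _] _] := HM; have [v _ <-] := s m I; exists v. Qed.

Lemma proj_fiber x y : p x = p y <-> exists2 g, G g & g x = y.
Proof. by have [_ _ _ [_ h _] _] := HM. Qed.

Lemma proj_deck g x : G g -> p (g x) = p x.
Proof. by move=> Gg; apply/esym/proj_fiber; exists g. Qed.

Lemma open_projP (U : set M) : open U <-> open (p @^-1` U).
Proof. by have [_ _ _ [_ _ h] _] := HM. Qed.

Lemma proj_cts : continuous p.
Proof. by apply/continuousP => U /open_projP. Qed.

Lemma proj_open (U : set V) : open U -> open (p @` U).
Proof.
move=> oU; apply/open_projP.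
have -> : p @^-1` (p @` U) = \bigcup_(g in G) (g @^-1` U).
  apply/seteqP; split=> [v [u Uu /esym/proj_fiber[g Gg gv]]|v [g Gg Ugv]].
    by exists g => //=; rewrite gv.
  by exists (g v) => //; rewrite proj_deck.
apply: bigcup_open => g _; apply: open_comp => // v _; exact: homeo_cts.
Qed.

Lemma compact_M : compact [set: M].
Proof. by have [_ _ _ _ []] := HM. Qed.

Lemma hausdorff_M : hausdorff_space M.
Proof. by have [_ _ _ _ []] := HM. Qed.

Lemma separating_radius_ex x : exists e : R, 0 < e /\
  forall g v, G g -> `|x - v| < e -> `|x - g v| < e -> g = 1%g.
Proof.
have [_ _ [_ pd] _ _] := HM; have [U [oU Ux h]] := pd x.
have : nbhs x U by apply: open_nbhs_nbhs.
move=> /nbhs_ballP[e /= e0 eU]; exists e; split=> // g v Gg xv xgv.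
apply: h => //; exists (g v); split; first by exists v => //; apply: eU; rewrite -ball_normE.
by apply: eU; rewrite -ball_normE.
Qed.

Definition sep_radius x := projT1 (cid (separating_radius_ex x)).

Lemma sep_radius_gt0 x : 0 < sep_radius x.
Proof. by rewrite /sep_radius; case: cid => e []. Qed.

Lemma sep_radiusP x g h v : G g -> G h ->
  `|x - g v| < sep_radius x -> `|x - h v| < sep_radius x -> g = h.
Proof.
rewrite /sep_radius; case: cid => e [_ H] /= Gg Gh xg xh.
apply: divg1_eq; apply: (H _ (h v)) => //.
  exact: deck_div.
by rewrite homeoME homeoK.
Qed.

Lemma deck_free g h v : G g -> G h -> g v = h v -> g = h.
Proof.
move=> Gg Gh e; apply: (@sep_radiusP (g v) _ _ v) => //.
  by rewrite subrr normr0 sep_radius_gt0.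
by rewrite -e subrr normr0 sep_radius_gt0.
Qed.

Lemma finite_orbit (K : set V) v : compact K ->
  exists s : seq (homeo V), forall g, G g -> K (g v) -> g \in s.
Proof.
move=> cK; have [|s hs] := @compact_finite _ _ K (fun y g => G g /\ g v = y) cK.
  move=> x _; pose c := xget 1%g [set g | G g /\ `|x - g v| < sep_radius x].
  exists [:: c].
  have : \forall y \near x, `|x - y| < sep_radius x.
    apply/nbhs_ballP; exists (sep_radius x); first exact: sep_radius_gt0.
    by rewrite -ball_normE.
  apply: filterS => y xy g [Gg gy]; rewrite inE; apply/eqP.
  have xg : `|x - g v| < sep_radius x by rewrite gy.
  have [Gc xc] : G c /\ `|x - c v| < sep_radius x.
    exact: (@xgetPex _ 1%g [set g | G g /\ `|x - g v| < sep_radius x] (ex_intro _ g (conj Gg xg))).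
  exact: sep_radiusP xg xc.
by exists s => g Gg Kg; apply: (hs (g v)).
Qed.

(** Properness of the action. Near a pair in one orbit, the separating radius leaves a single
    candidate; for a pair in different orbits, it is the Hausdorff property of [M] that excludes all
    of them. *)
Lemma finite_meeting (K : set V) : compact K ->
  exists s : seq (homeo V), forall g v, G g -> K v -> K (g v) -> g \in s.
Proof.
move=> cK.
have [|s hs] := @compact_finite (V * V)%type _ (K `*` K) (fun q g => G g /\ g q.1 = q.2)
    (compact_setX cK cK); last first.
  by exists s => g v Gg Kv Kgv; apply: (hs (v, g v)).
move=> [x y] _ /=; have [pxy|pxy] := pselect (p x = p y).
  have [h Gh hx] := (proj_fiber x y).1 pxy.
  exists [:: h]; exists (h @^-1` ball y (sep_radius y), ball y (sep_radius y)).
    split; last exact: nbhsx_ballx (sep_radius_gt0 y).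
    apply: (@homeo_cts _ h x); rewrite hx; exact: nbhsx_ballx (sep_radius_gt0 y).
  case=> a c; rewrite -ball_normE /= => -[ya yc] g [Gg ga]; rewrite inE; apply/eqP.
  by apply: (@sep_radiusP y _ _ a Gg Gh) => //; rewrite ga.
have := hausdorff_M; rewrite open_hausdorff => /(_ (p x) (p y)).
case=> [|[A B] /= [/set_mem Ax /set_mem By] [oA oB /eqP AB0]].
  by apply/eqP => /pxy.
exists [::]; exists (p @^-1` A, p @^-1` B).
  split; apply: proj_cts; exact: open_nbhs_nbhs.
case=> a b /= [Aa Bb] g [Gg ga]; have : (A `&` B) (p a).
  by split=> //; rewrite -(proj_deck a Gg) ga.
by rewrite AB0.
Qed.

Lemma finite_cover (r : V -> R) : (forall x, 0 < r x) ->
  exists s : seq V, forall v, exists2 x, x \in s & exists2 g, G g & `|x - g v| < r x.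
Proof.
move=> r0.
have [|s _ /(_ s (fun x => id)) hs] := (compact_near_coveringP [set: M]).1 compact_M _ _
  (fun (s : seq V) m => exists2 x, x \in s & (p @` ball x (r x)) m) (@seq_inclusion_filter V).
  move=> m _; have [v <-] := proj_surj m.
  exists (p @` ball v (r v), [set t : seq V | v \in t]).
    split; last by exists [:: v] => // t vt; apply: vt; rewrite inE.
    apply: open_nbhs_nbhs; split; first exact/proj_open/row_ball_open.
    by exists v => //; exact/ballxx/r0.
  by case=> m' t [vm' vt]; exists v.
exists s => v; have [x xs [w xw /esym/proj_fiber[g Gg gv]]] := hs (p v) I.
by exists x => //; exists g => //; rewrite gv; move: xw; rewrite -ball_normE.
Qed.

(** It is the preimage of a compact subset of the Hausdorff space [M]. Closedness is what makes
    [push] continuous where its support ends. *)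
Lemma closed_orbit_cball x (e : R) :
  closed [set v | exists2 g, G g & `|x - g v| <= e].
Proof.
have -> : [set v | exists2 g, G g & `|x - g v| <= e] =
    p @^-1` (p @` [set y | `|x - y| <= e]).
  apply/seteqP; split=> [v [g Gg gv]|v [u xu /esym/proj_fiber[g Gg gv]]].
    by exists (g v) => //; rewrite proj_deck.
  by exists g => //; rewrite gv.
apply: preimage_closed; first by move=> v _; exact: proj_cts.
apply: compact_closed; first exact: hausdorff_M.
apply: continuous_compact; last exact: compact_cball.
by apply: continuous_subspaceT; exact: proj_cts.
Qed.

Lemma bounded_domain : exists b : R, 0 < b /\ forall v, exists2 g, G g & `|g v| < b.
Proof.
have [s sP] := finite_cover (fun=> ltr01).
exists (\sum_(x <- s) `|x| + 1); split; first by rewrite ltr_wpDl // sumr_ge0.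
move=> v; have [x xs [g Gg xg]] := sP v; exists g => //.
have -> : g v = x - (x - g v) by rewrite opprB [RHS]addrC subrK.
apply: le_lt_trans (ler_normB _ _) _; rewrite ler_ltD //.
by rewrite (big_rem x) //= lerDl sumr_ge0.
Qed.

Lemma countable_deck : countable G.
Proof.
have sub : G `<=` \bigcup_(k in [set: nat]) [set g | G g /\ `|g 0| <= k%:R].
  move=> g Gg; exists (Num.bound `|g 0|) => //; split=> //.
  exact/ltW/archi_boundP.
apply: sub_countable (subset_card_le sub) _; apply: bigcup_countable => // k _.
apply: finite_set_countable.
have [s hs] := finite_orbit 0 (@compact_cball R n 0 k%:R).
apply: (@sub_finite_set _ _ [set` s]); last exact: finite_seq.
by move=> g /= [Gg gk]; apply: hs; rewrite //= sub0r normrN.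
Qed.

End Action.

Section Bump.
Variables (R : realType) (n : nat) (r : R) (x : 'rV[R]_n).
Local Notation V := 'rV[R]_n.
Hypothesis r_gt0 : 0 < r.

Definition bump (v : V) : R := Order.min 1 (Order.max 0 (2 - `|x - v| / r)).

Lemma bump_continuous : continuous bump.
Proof.
move=> v; pose f v : R := 2 - `|x - v| / r.
apply: (@continuous_min R V (fun=> 1) (fun v => Order.max 0 (f v)) v).
  exact: cst_continuous.
apply: (@continuous_max R V (fun=> 0) f v); first exact: cst_continuous.
apply: continuousB; first exact: cst_continuous.
apply: continuousM; last exact: cst_continuous.
apply: (@continuous_comp V V R (fun v => x - v) (fun v : V => `|v|)).
  by apply: continuousB; [exact: cst_continuous|exact: cvg_id].
exact: (@norm_continuous R 'rV[R]_n).
Qed.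

Lemma bump_itv v : 0 <= bump v <= 1.
Proof. by rewrite le_min ler01 le_max lexx ge_min lexx. Qed.

Lemma bump1 v : `|x - v| <= r -> bump v = 1.
Proof.
move=> h; have {}h : `|x - v| / r <= 1 by rewrite ler_pdivrMr ?mul1r.
apply/min_idPl; rewrite le_max; apply/orP; right.
by rewrite lerBrDr; lra.
Qed.

Lemma bump0 v : 2 * r <= `|x - v| -> bump v = 0.
Proof.
move=> h; have {}h : 2 <= `|x - v| / r by rewrite ler_pdivlMr.
by rewrite /bump max_l ?min_r // subr_le0.
Qed.

End Bump.

(** * Equivariant deformation into an invariant convex set *)

Section Retraction.
Variables (R : realType) (n : nat) (G : set (homeo 'rV[R]_n)).
Variables (M : topologicalType) (p : 'rV[R]_n -> M).
Local Notation V := 'rV[R]_n.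
Hypothesis HM : compact_complete_polynomial_manifold G p.
Implicit Types (g h : homeo V) (x y v w : V).

(** With the divisor 4, the element bringing a point within [3 * rad x] of [x] is still unique,
    while the bump vanishes from [2 * rad x] on; the margin between 2 and 3 serves continuity. *)
Definition rad x := sep_radius HM x / 4.

Lemma rad_gt0 x : 0 < rad x.
Proof. by rewrite divr_gt0 // sep_radius_gt0. Qed.

Lemma rad_inj x g h v : G g -> G h ->
  `|x - g v| < 3 * rad x -> `|x - h v| < 3 * rad x -> g = h.
Proof.
have h34 : 3 * rad x < sep_radius HM x.
  by have := rad_gt0 x; rewrite /rad => ?; lra.
by move=> Gg Gh xg xh; apply: (sep_radiusP (HM := HM) (x := x) (v := v) Gg Gh); apply: lt_trans h34.
Qed.

(* Within distance [3 * rad x] of the orbit of [x], push [w] towards the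
   corresponding translate of [x0] along a segment straightened by the deck
   transformation bringing [v] near [x]. *)
Definition push (x0 x : V) (t : R) v w : V :=
  match pselect (exists g, G g /\ `|x - g v| < 3 * rad x) with
  | left e => let g := projT1 (cid e) in
     (g^-1)%g ((t * bump (rad x) x (g v)) *: x0 + (1 - t * bump (rad x) x (g v)) *: g w)
  | right _ => w
  end.

Lemma pushE x0 x t v w g : G g -> `|x - g v| < 3 * rad x ->
  push x0 x t v w =
  (g^-1)%g ((t * bump (rad x) x (g v)) *: x0 + (1 - t * bump (rad x) x (g v)) *: g w).
Proof.
move=> Gg xg; rewrite /push; case: pselect => [e|[]]; last by exists g.
case: cid => h [Gh xh] /=.
by have -> := rad_inj Gh Gg xh xg.
Qed.

Lemma push_far x0 x t v w :
  (forall g, G g -> 2 * rad x < `|x - g v|) -> push x0 x t v w = w.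
Proof.
move=> far; rewrite /push; case: pselect => [e|//].
case: cid => h [Gh xh] /=.
have -> : bump (rad x) x (h v) = 0 by apply: (bump0 (rad_gt0 x)); apply: ltW; apply: far.
by rewrite mulr0 subr0 scale0r add0r scale1r; exact: homeoK.
Qed.

Lemma push0 x0 x v w : push x0 x 0 v w = w.
Proof.
rewrite /push; case: pselect => [e|//].
by rewrite mul0r subr0 scale0r add0r scale1r; exact: homeoK.
Qed.

Lemma push_deck x0 x t v w h : G h -> push x0 x t (h v) (h w) = h (push x0 x t v w).
Proof.
move=> Gh; have [[g [Gg xg]]|nex] := pselect (exists g, G g /\ `|x - g (h v)| < 3 * rad x).
  rewrite (pushE _ _ _ Gg xg) (@pushE _ x t v w (g * h)%g) //; last exact: (deckM HM).
  by rewrite invgM !homeoME homeoVK.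
rewrite /push; case: pselect => [[g [Gg xg]]|_]; first by case: nex; exists g.
case: pselect => // -[g [Gg xg]]; case: nex; exists (g / h)%g.
by rewrite homeoME homeoK; split=> //; apply: (deck_div HM).
Qed.

Lemma push_convex (F : set V) x0 x t v w :
  (forall x y (t : R), 0 <= t <= 1 -> F x -> F y -> F (t *: x + (1 - t) *: y)) ->
  (forall g v, G g -> F v -> F (g v)) ->
  F x0 -> F w -> 0 <= t <= 1 -> F (push x0 x t v w).
Proof.
move=> Fc FG F0 Fw /andP[t0 t1]; rewrite /push; case: pselect => [e|//].
case: cid => g [Gg xg] /=; apply: (FG (g^-1)%g); first exact: (deckV HM).
have /andP[b0 b1] := bump_itv (rad x) x (g v).
apply: Fc => //; last exact: FG.
by rewrite mulr_ge0 // mulr_ile1.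
Qed.

Lemma push1 (F : set V) x0 x v w g :
  (forall g v, G g -> F v -> F (g v)) -> F x0 ->
  G g -> `|x - g v| <= rad x -> F (push x0 x 1 v w).
Proof.
move=> FG F0 Gg xg; rewrite (pushE _ _ _ Gg); last first.
  by apply: le_lt_trans xg _; have := rad_gt0 x => ?; lra.
rewrite bump1 ?rad_gt0 // mulr1 subrr scale1r scale0r addr0.
by apply: FG => //; apply: (deckV HM).
Qed.

(** Within [3 * rad x] of the orbit, the formula of [pushE] holds with one fixed [g] on a
    neighbourhood. Elsewhere [push] is locally the identity, since the tube of radius [2 * rad x] is
    closed. *)
Lemma push_continuous (T : topologicalType) (t : T -> R) (v w : T -> V) x0 x :
  continuous t -> continuous v -> continuous w ->
  continuous (fun q => push x0 x (t q) (v q) (w q)).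
Proof.
move=> ct cv cw q.
have cg (g : homeo V) : continuous (fun q => g (v q)).
  by move=> z; apply: (continuous_comp (cv z)); exact: homeo_cts.
have cgw (g : homeo V) : continuous (fun q => g (w q)).
  by move=> z; apply: (continuous_comp (cw z)); exact: homeo_cts.
have [[g [Gg xg]]|nex] := pselect (exists g, G g /\ `|x - g (v q)| < 3 * rad x).
  apply: (@cvg_near_eq _ _ _ (fun q => (g^-1)%g ((t q * bump (rad x) x (g (v q))) *: x0 +
      (1 - t q * bump (rad x) x (g (v q))) *: g (w q)))); last first.
    have : \forall q' \near q, `|x - g (v q')| < 3 * rad x.
      apply: (@open_nbhs_nbhs _ q [set q' | `|x - g (v q')| < 3 * rad x]); split=> //.
      apply: (@open_comp _ _ (fun q => g (v q)) [set y | `|x - y| < 3 * rad x]).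
        by move=> z _; exact: cg.
      have -> : [set y | `|x - y| < 3 * rad x] = ball x (3 * rad x).
        by rewrite -ball_normE.
      exact: row_ball_open.
    by apply: filterS => q' xq'; rewrite (pushE _ _ _ Gg xq').
  have ctb : {for q, continuous (fun q => t q * bump (rad x) x (g (v q)))}.
    apply: continuousM; first exact: ct.
    by apply: (continuous_comp (cg g q)); exact: bump_continuous.
  apply: (@continuous_comp _ _ _ (fun q => (t q * bump (rad x) x (g (v q))) *: x0 +
      (1 - t q * bump (rad x) x (g (v q))) *: g (w q)) (g^-1)%g); last exact: homeo_cts.
  apply: continuousD; first by apply: continuousZr_tmp.
  apply: continuousZ; last exact: cgw.
  by apply: continuousB; [exact: cst_continuous|].
apply: (@cvg_near_eq _ _ _ w); first exact: cw.
have oC : open (v @^-1` ~` [set y | exists2 g, G g & `|x - g y| <= 2 * rad x]).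
  apply: open_comp; first by move=> z _; exact: cv.
  by apply: closed_openC; exact: (closed_orbit_cball HM).
have : \forall q' \near q, ~ (exists2 g, G g & `|x - g (v q')| <= 2 * rad x).
  apply: (open_nbhs_nbhs (conj oC _)) => -[g Gg xg]; apply: nex; exists g; split=> //.
  by apply: le_lt_trans xg _; have := rad_gt0 x => ?; lra.
apply: filterS => q' hq; apply: push_far => g Gg; rewrite ltNge; apply/negP => h.
by apply: hq; exists g.
Qed.

(** The initial point [v], not the point as moved so far, decides which pushes act; hence at time 1
    a centre near the orbit of [v] is sure to act fully. *)
Definition pushes x0 (s : seq V) t v := foldr (fun x w => push x0 x t v w) v s.

Lemma pushes0 x0 s v : pushes x0 s 0 v = v.
Proof. by elim: s => //= x s IH; rewrite push0. Qed.

Lemma pushes_deck x0 s t v h : G h -> pushes x0 s t (h v) = h (pushes x0 s t v).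
Proof. by move=> Gh; elim: s => //= x s IH; rewrite IH push_deck. Qed.

Lemma pushes_continuous x0 s : continuous (fun q : R * V => pushes x0 s q.1 q.2).
Proof.
elim: s => [|x s IH] /=; first by move=> q; exact: cvg_snd.
by apply: push_continuous => // q; [exact: cvg_fst|exact: cvg_snd].
Qed.

(** The push centred at a point near the orbit of [v] lands in [F]; by convexity and invariance the
    later ones stay there. *)
Lemma pushes1 (F : set V) x0 s v :
  (forall x y (t : R), 0 <= t <= 1 -> F x -> F y -> F (t *: x + (1 - t) *: y)) ->
  (forall g v, G g -> F v -> F (g v)) -> F x0 ->
  (exists2 x, x \in s & exists2 g, G g & `|x - g v| < rad x) ->
  F (pushes x0 s 1 v).
Proof.
move=> Fc FG F0 [x xs [g Gg xg]].
elim: s xs => //= y s IH; rewrite inE => /predU1P[<-|xs].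
  by apply: (push1 _ FG F0 Gg); apply: ltW.
by apply: push_convex => //; [exact: IH|rewrite ler01 lexx].
Qed.


(* [pushes] is a [G]-equivariant homotopy from the identity to a map into [F].
   By cocompactness it takes the value [y0] in a bounded region only; damping it
   far away gives a map that is the identity near the boundary of a large cube
   and misses [y0]. *)
Lemma convex_invariant_full (F : set V) : F !=set0 ->
  (forall x y (t : R), 0 <= t <= 1 -> F x -> F y -> F (t *: x + (1 - t) *: y)) ->
  (forall g v, G g -> F v -> F (g v)) -> forall v, F v.
Proof.
move=> [x0 F0] Fc FG y0; apply: contrapT => nFy0.
have [xs xsP] := finite_cover HM rad_gt0.
have [b hb] := @seq_compact_bound R n V xs _ (fun x => @compact_cball R n x (rad x)).
pose K := [set v : V | `|0 - v| <= b].
have GK v : exists2 g, G g & K (g v).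
  have [x xxs [g Gg xg]] := xsP v; exists g => //; rewrite /K /= sub0r normrN.
  by apply: hb xxs _; apply: ltW.
(* If [v] reaches [y0] at some time and [g v] is in [K], then by equivariance [g y0] is in the
   compact set [L]. This allows finitely many [g], so [v] is bounded. *)
pose L := (fun q : R * V => pushes x0 xs q.1 q.2) @` (`[0, 1]%classic `*` K).
have cL : compact L.
  apply: continuous_compact.
    by apply: continuous_subspaceT; exact: pushes_continuous.
  by apply: compact_setX; [exact: segment_compact|exact: compact_cball].
have [s hs] := finite_orbit HM y0 cL.
have [c hc] := @seq_compact_bound R n _ s (fun g : homeo V => (g^-1)%g @` K)
  (fun g => continuous_compact (continuous_subspaceT (@homeo_cts _ (g^-1)%g)) (@compact_cball R n 0 b)).
pose a := Order.max (c + 1) (`|y0| + 1).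
have ya : `|y0| < a by rewrite /a lt_max [_ < `|y0| + 1]ltrDl ltr01 orbT.
have a0 : 0 < a by apply: le_lt_trans ya.
have zero_lt (t : R) v : 0 <= t <= 1 -> pushes x0 xs t v = y0 -> `|v| < a.
  move=> t01 e; have [g Gg Kg] := GK v.
  have gs : g \in s.
    apply: hs => //; rewrite -e -pushes_deck //; exists (t, g v) => //.
  have vc : `|v| <= c by apply: (hc g v gs); exists (g v) => //; exact: homeoK.
  by rewrite /a lt_max (le_lt_trans vc) // ltrDl.
(* The time is 1 for [|v| <= a], where the value lies in [F] and is not [y0]; beyond [a], [zero_lt]
   excludes the value [y0] at every time. *)
pose rho v := pushes x0 xs (bump a 0 v) v - y0.
have rho_far v : 2 * a <= `|v| -> rho v = v - y0.
  by move=> va; rewrite /rho bump0 ?pushes0 // sub0r normrN.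
have crho : continuous rho.
  move=> v; apply: (@continuousB R V V (fun v => pushes x0 xs (bump a 0 v) v) (fun=> y0));
    last exact: cst_continuous.
  apply: (@continuous2_cvg V R V V (nbhs v) _ (bump a 0) id (pushes x0 xs)).
  - exact: (@pushes_continuous x0 xs (bump a 0 v, v)).
  - exact: bump_continuous.
  - exact: cvg_id.
have a20 : 0 < 2 * a by rewrite mulr_gt0.
have [x i _ xi|x i _ xi|v _] := @poincare_miranda R n rho (2 * a) a20 crho.
- have xa : 2 * a <= `|x|.
    by apply: le_trans (norm_coord x i); rewrite xi normrN ger0_norm // mulr_ge0 // ltW.
  rewrite rho_far // !mxE xi.
  by have := le_lt_trans (norm_coord y0 i) ya; rewrite ltr_norml => /andP[? ?]; lra.
- have xa : 2 * a <= `|x|.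
    by apply: le_trans (norm_coord x i); rewrite xi ger0_norm // mulr_ge0 // ltW.
  rewrite rho_far // !mxE xi.
  by have := le_lt_trans (norm_coord y0 i) ya; rewrite ltr_norml => /andP[? ?]; lra.
move=> /eqP; rewrite subr_eq0 => /eqP e; have va := zero_lt _ _ (bump_itv a 0 v) e.
apply: nFy0; rewrite -e bump1 // ?sub0r ?normrN ?ltW //.
exact: pushes1.
Qed.

End Retraction.

(** * Nilpotent algebras of matrices *)

Section Nilpotent.
Variable F : numFieldType.

(** A form of Fitting's lemma: on the image of [X ^+ m.+1], [X] has an inverse that is a polynomial
    in [X]. It comes from Cayley-Hamilton by splitting the power of ['X] off the characteristic
    polynomial. *)
Lemma expmx_stable m (X : 'M[F]_m.+1) :
  exists q : {poly F}, X ^+ m.+1 = X ^+ m.+2 * horner_mx X q.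
Proof.
have p0 : char_poly X != 0 by rewrite monic_neq0 // char_poly_monic.
have [k [q /implyP/(_ p0) q0 pE]] := multiplicity_XsubC (char_poly X) 0.
rewrite subr0 in pE.
have qn0 : q != 0 by apply: contraNneq p0 => q00; rewrite pE q00 mul0r.
have km : (k <= m.+1)%N.
  have := size_char_poly X; rewrite pE size_mul //; last by rewrite monic_neq0 ?monicXn.
  by rewrite size_polyXn addnS /= => sz; rewrite -ltnS -sz -{1}[k]add0n ltn_add2r size_poly_gt0.
have [q' qE] : exists q' : {poly F}, q = q' * 'X + (q.[0])%:P.
  have /factor_theorem[r hr] : root (q - (q.[0])%:P) 0.
    by rewrite rootE !hornerE subrr.
  by exists r; rewrite -[q in LHS](subrK (q.[0])%:P) hr subr0.
have c0 : q.[0] != 0 by [].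
pose c := (q.[0]^-1)%:P : {poly F}.
have cE : c * (q.[0])%:P = 1 by rewrite -polyCM mulVf.
have Xk : 'X^(m.+1) = 'X^(m.+2) * (- c * q') + char_poly X * (c * 'X^(m.+1 - k)) :> {poly F}.
  have e : 'X^(m.+1) = 'X^k * 'X^(m.+1 - k) :> {poly F} by rewrite -exprD (subnKC km).
  rewrite pE {1}qE (exprS _ m.+1) e.
  rewrite -[LHS]mul1r -cE.
  by ring.
exists (- c * q'); have := congr1 (horner_mx X) Xk.
by rewrite !(rmorphD, rmorphM) /= !rmorphXn /= horner_mx_X Cayley_Hamilton mul0r addr0.
Qed.

Lemma expmx_stablen m (X : 'M[F]_m.+1) :
  exists q : {poly F}, forall j, X ^+ m.+1 = X ^+ (m.+1 + j) * (horner_mx X q) ^+ j.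
Proof.
have [q qE] := expmx_stable X; exists q; elim=> [|j IH]; first by rewrite addn0 mulr1.
set Z := horner_mx X q in qE IH *.
rewrite {1}IH (addnC _ j) exprD qE mulrA -exprD -mulrA -exprS.
by rewrite addnC addSnnS.
Qed.

Lemma expmx_kernel m k (X : 'M[F]_m.+1) (u : 'rV_m.+1) j :
  u *m X ^+ j = 0 -> (m < k)%N -> u *m X ^+ k = 0.
Proof.
move=> uj mk; have [q qE] := expmx_stablen X.
rewrite -(subnKC mk) exprD (qE j) addnC exprD -!mulrA mulmxA.
by rewrite uj mul0mx.
Qed.

(** Induction on the size: exchanging the two factors of a rank factorization keeps the trace and
    nilpotency and gives a smaller matrix. *)
Lemma trace_nilpotent m k (X : 'M[F]_m) : X ^+ k = 0 -> \tr X = 0.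
Proof.
elim/ltn_ind: m k X => m IH k X Xk.
have [full|] := boolP (row_full X).
  case: m IH X Xk full => [|m] _ X Xk full; first by rewrite /mxtrace big_ord0.
  have : X ^+ k \is a GRing.unit by rewrite unitrX // -row_full_unit.
  by rewrite Xk unitr0.
rewrite /row_full => nfull.
have rm : (\rank X < m)%N by rewrite ltn_neqAle nfull rank_leq_col.
rewrite -(mulmx_base X) mxtrace_mulC; apply: (IH _ rm k.+1).
have E r (B : 'M[F]_(r, m)) (C : 'M[F]_(m, r)) j :
    (B *m C) ^+ j.+1 = B *m (C *m B) ^+ j *m C.
  elim: j => [|j IHj]; first by rewrite expr1 expr0 mulmx1.
  by rewrite exprSr IHj exprSr -![_ * _]/(_ *m _) !mulmxA.
by rewrite E mulmx_base Xk mulmx0 mul0mx.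
Qed.

Lemma idempotent_trace0 m (e : 'M[F]_m) : e * e = e -> \tr e = 0 -> e = 0.
Proof.
move=> ee te.
have [r [C [B [eE fB fC rE]]]] : exists r (C : 'M_(m, r)) (B : 'M_(r, m)),
    [/\ e = C *m B, row_free B, row_full C & r = \rank e].
  exists (\rank e), (col_base e), (row_base e).
  by split; rewrite ?mulmx_base ?row_base_free ?col_base_full.
have e1 : B *m C = 1%:M.
  apply: (row_free_inj fB); apply: (row_full_inj fC).
  by move: ee; rewrite -[_ * _]/(_ *m _) eE mul1mx !mulmxA.
move: te; rewrite {1}eE mxtrace_mulC e1 mxtrace1 rE.
by move/eqP; rewrite pnatr_eq0 mxrank_eq0 => /eqP.
Qed.

(** The Fitting idempotent [e] is a polynomial in [X] without constant term, so its trace is 0. The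
    trace of an idempotent is its rank, hence [e = 0]. *)
Lemma trace0_nilpotent m (X : 'M[F]_m.+1) :
  (forall k, \tr (X ^+ k.+1) = 0) -> X ^+ m.+1 = 0.
Proof.
move=> trX; have [q qE] := expmx_stablen X.
pose e := horner_mx X ('X^(m.+1) * q ^+ m.+1).
have hX k : X ^+ k = horner_mx X 'X^k by rewrite rmorphXn /= horner_mx_X.
have qE' : X ^+ m.+1 = horner_mx X ('X^(m.+1 + m.+1) * q ^+ m.+1).
  by rewrite rmorphM /= -hX rmorphXn /= -qE.
have Xe : X ^+ m.+1 * e = X ^+ m.+1.
  by rewrite [RHS]qE' hX -rmorphM /= mulrA -exprD.
have ee : e * e = e.
  rewrite {3}/e [in RHS]rmorphM /= -hX qE' -!rmorphM /=; congr (horner_mx X _).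
  by rewrite exprD; ring.
have te : \tr e = 0.
  pose r : {poly F} := 'X^m * q ^+ m.+1.
  have -> : e = horner_mx X (r * 'X) by rewrite /e /r (exprSr 'X m) mulrAC.
  rewrite -[r]coefK poly_def mulr_suml rmorph_sum /= raddf_sum /= big1 // => i _.
  by rewrite -scalerAl -exprSr linearZ /= -hX linearZ /= trX mulr0.
by rewrite -Xe (idempotent_trace0 ee te) mulr0.
Qed.
End Nilpotent.

Lemma finite_spanning (F : fieldType) (vT : vectType F) (D : vT -> Prop) :
  exists X : seq vT, (forall x, x \in X -> D x) /\ (forall x, D x -> x \in <<X>>%VS).
Proof.
pose P k := `[< exists X : seq vT, (forall x, x \in X -> D x) /\ \dim <<X>> = k >].
have P0 : exists k, P k by exists 0%N; apply/asboolP; exists [::]; rewrite span_nil dimv0.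
have Pb k : P k -> (k <= \dim {:vT})%N.
  by move=> /asboolP[X [_ <-]]; apply: dimvS; apply: subvf.
case: (ex_maxnP P0 Pb) => k /asboolP[X [XD dX]] kmax; exists X; split=> // x Dx.
have /kmax : P (\dim <<x :: X>>).
  apply/asboolP; exists (x :: X); split=> // y; rewrite inE => /predU1P[->|/XD] //.
rewrite -dX => le.
have sub : (<<X>> <= <<x :: X>>)%VS by rewrite span_cons addvSr.
have /eqP -> : (<<X>>%VS == <<x :: X>>%VS) by rewrite eqEdim sub le.
by apply: memv_span; rewrite inE eqxx.
Qed.

Section Kolchin.
Variables (F : numFieldType) (m : nat).
Local Notation N := m.+1.
Local Notation Mat := 'M[F]_N.

Section NilAlgebra.
Variable A : {vspace Mat}.
Hypothesis A_mul : forall a b, a \in A -> b \in A -> a * b \in A.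
Hypothesis A_nil : forall a, a \in A -> a ^+ N = 0.

Definition invariant (U : {vspace 'rV[F]_N}) :=
  forall u a, u \in U -> a \in A -> u *m a \in U.

(* Let [W] be a minimal invariant space strictly above [U] and [v] in [W] but
   not in [U].  If [v *m A] is not contained in [U], then [U + v *m A = W], so
   [v = u + v *m b] with [u] in [U]; as [b] is nilpotent, [v] is in [U]. *)
Lemma killed_mod U : invariant U -> U != fullv ->
  exists2 v, v \notin U & forall a, a \in A -> v *m a \in U.
Proof.
move=> iU Uf.
pose P k := `[< exists W, [/\ invariant W, (U <= W)%VS, ~~ (W <= U)%VS & \dim W = k] >].
have Pex : exists k, P k.
  exists (\dim {: 'rV[F]_N}); apply/asboolP; exists fullv; split=> //.
  - by move=> *; exact: memvf.
  - exact: subvf.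
  - by apply: contra Uf => h; rewrite eqEsubv subvf h.
case: (ex_minnP Pex) => k /asboolP[W [iW UW nWU dW]] kmin.
have /subvPn[v vW vU] := nWU.
exists v => // a aA; apply: contrapT => /negP va.
pose f := linfun (mulmx v : Mat -> 'rV[F]_N).
pose W' := (U + f @: A)%VS.
have W'W : (W' <= W)%VS.
  rewrite subv_add UW; apply/subvP => _ /memv_imgP[b bA ->].
  by rewrite lfunE; exact: iW.
have /kmin : P (\dim W').
  apply/asboolP; exists W'; split; [|exact: addvSl| |by []].
    move=> _ b /memv_addP[u uU [_ /memv_imgP[c cA ->] ->]] bA.
    rewrite lfunE mulmxDl memv_add //; first exact: iU.
    by apply/memv_imgP; exists (c * b); [exact: A_mul|rewrite lfunE /= mulmxA].
  apply/subvPn; exists (f a); last by rewrite lfunE.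
  by apply: (subvP (addvSr _ _)); exact: memv_img.
rewrite -dW => dWW'.
have WE : W' = W by apply/eqP; rewrite eqEdim W'W.
move: vW; rewrite -WE => /memv_addP[u uU [_ /memv_imgP[b bA ->]]].
rewrite lfunE /= => vE.
have vk k' : exists2 w, w \in U & v = w + v *m b ^+ k'.
  elim: k' => [|k' [w wU IH]].
    by exists 0; rewrite ?mem0v // expr0 mulmx1 add0r.
  exists (w + u *m b ^+ k').
    rewrite memvD //; case: k' {IH} => [|j]; first by rewrite expr0 mulmx1.
    apply: iU => //; elim: j => [|j IHj]; first by rewrite expr1.
    by rewrite exprS A_mul.
  by rewrite exprS mulmxA -addrA -mulmxDl -vE.
have [w wU] := vk N; rewrite A_nil // mulmx0 addr0 => vw.
by move: vU; rewrite vw wU.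
Qed.

(** A flag built by adjoining a vector of [killed_mod] at each step; after [N] steps the dimension
    bound makes it the whole space. *)
Lemma nil_chain d : exists U : {vspace 'rV[F]_N},
  [/\ invariant U, (minn d N <= \dim U)%N &
   forall u (s : seq Mat), u \in U -> (forall a, a \in s -> a \in A) ->
     size s = d -> u *m (\prod_(a <- s) a) = 0].
Proof.
elim: d => [|d [U [iU dU kU]]].
  exists 0%VS; split.
  - by move=> u a; rewrite !memv0 => /eqP-> _; rewrite mul0mx.
  - by rewrite min0n.
  - by move=> u s; rewrite memv0 => /eqP-> _ _; rewrite mul0mx.
have [Uf|Uf] := eqVneq U fullv.
  exists U; split=> //.
    by rewrite Uf dimvf /= /dim /= mul1n geq_minr.
  move=> u [|a s] // uU sA [ss]; rewrite big_cons mulmxA kU //.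
    by apply: iU => //; apply: sA; rewrite inE eqxx.
  by move=> b bs; apply: sA; rewrite inE bs orbT.
have [v vU vA] := killed_mod iU Uf.
have step w : w \in (U + <[v]>)%VS -> forall a, a \in A -> w *m a \in U.
  move=> /memv_addP[u uU [_ /vlineP[c ->] ->]] a aA.
  by rewrite mulmxDl -scalemxAl memvD ?memvZ ?vA // iU.
exists (U + <[v]>)%VS; split.
- by move=> w a wU aA; apply: (subvP (addvSl _ _)); exact: step.
- have : (\dim U < \dim (U + <[v]>))%N.
    rewrite ltn_neqAle dimvS ?addvSl // andbT; apply/negP => /eqP e.
    have /eqP h : U == (U + <[v]>)%VS by rewrite eqEdim addvSl e /=.
    by move: vU; rewrite h (subvP (addvSr _ _)) ?memv_line.
  move=> h; apply: leq_trans h.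
  by rewrite (leq_trans _ (_ : (minn d N).+1 <= _)%N) // -minnSS leq_min geq_minl (leq_trans (geq_minr _ _)).
- move=> w [|a s] // wU sA [ss]; rewrite big_cons mulmxA kU //.
    by apply: step => //; apply: sA; rewrite inE eqxx.
  by move=> b bs; apply: sA; rewrite inE bs orbT.
Qed.

Lemma nil_algebra_nilpotent (s : seq Mat) : (forall a, a \in s -> a \in A) ->
  size s = N -> \prod_(a <- s) a = 0.
Proof.
move=> sA ss; have [U [_ dU kU]] := nil_chain N.
have /eqP Uf : U == fullv by rewrite eqEdim subvf dimvf /= /dim /= mul1n -{1}[N]minnn.
apply/row_matrixP => i; rewrite row0 rowE kU //.
by rewrite Uf memvf.
Qed.
End NilAlgebra.

(** The span of the [a - 1] is closed under products because [(c - 1) * (d - 1)] is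
    [(c * d - 1) - (c - 1) - (d - 1)]. It is spanned by nilpotent matrices, so all its elements,
    hence all their powers, have trace 0, and [trace0_nilpotent] applies. *)
Lemma kolchin (S : Mat -> Prop) :
  (forall a b, S a -> S b -> S (a * b)) ->
  (forall a, S a -> exists k, (a - 1) ^+ k = 0) ->
  forall s : seq Mat, (forall a, a \in s -> S a) -> size s = N ->
    \prod_(a <- s) (a - 1) = 0.
Proof.
move=> SM Su s sS ss.
have [X [XD DX]] := finite_spanning (fun x : Mat => exists2 a, S a & x = a - 1).
have spanP x : x \in <<X>>%VS -> x = \sum_(i < size X) coord (in_tuple X) i x *: X`_i.
  exact: (@coord_span _ _ _ (in_tuple X)).
have XA i : (i < size X)%N -> exists2 a, S a & X`_i = a - 1.
  by move=> iX; apply: XD; exact: mem_nth.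
have AM a b : a \in <<X>>%VS -> b \in <<X>>%VS -> a * b \in <<X>>%VS.
  move=> /spanP -> /spanP ->; rewrite mulr_suml; apply: memv_suml => i _.
  rewrite mulr_sumr; apply: memv_suml => j _.
  rewrite -scalerAl -scalerAr !memvZ //.
  have [c Sc ->] := XA i (ltn_ord i); have [d Sd ->] := XA j (ltn_ord j).
  have -> : (c - 1) * (d - 1) = (c * d - 1) - (c - 1) - (d - 1).
    by rewrite mulrBl mulrBr mulr1 mul1r; congr (_ - _); rewrite opprB addrA subrK.
  have mX e : S e -> e - 1 \in <<X>>%VS by move=> Se; apply: DX; exists e.
  by apply: memvB; [apply: memvB|]; apply: mX => //; exact: SM.
have tr0 a : a \in <<X>>%VS -> \tr a = 0.
  move=> /spanP ->; rewrite raddf_sum big1 // => i _.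
  have [c Sc ->] := XA i (ltn_ord i); have [k ck] := Su c Sc.
  by rewrite /= mxtraceZ (trace_nilpotent ck) mulr0.
have An a : a \in <<X>>%VS -> a ^+ N = 0.
  move=> aX; apply: trace0_nilpotent => k; apply: tr0.
  by elim: k => [|k IH]; [rewrite expr1|rewrite exprS AM].
rewrite -(big_map (fun a => a - 1) predT id).
apply: (nil_algebra_nilpotent AM An); last by rewrite size_map.
by move=> _ /mapP[a /sS Sa ->]; apply: DX; exists a.
Qed.
End Kolchin.

(** * Affine maps commuting with the deck group *)

Section PolynomialSequence.
Variable R : realType.
Implicit Types s t : nat -> R.

Definition polyseq s := exists P : {poly R}, forall k, s k = P.[k%:R].

Lemma polyseq_cst c : polyseq (fun=> c).
Proof. by exists c%:P => k; rewrite hornerC. Qed.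

Lemma polyseqD s t : polyseq s -> polyseq t -> polyseq (fun k => s k + t k).
Proof. by move=> [P sP] [Q tQ]; exists (P + Q) => k; rewrite hornerD sP tQ. Qed.

Lemma polyseqM s t : polyseq s -> polyseq t -> polyseq (fun k => s k * t k).
Proof. by move=> [P sP] [Q tQ]; exists (P * Q) => k; rewrite hornerM sP tQ. Qed.

Lemma polyseq_sum (I : Type) (r : seq I) (f : I -> nat -> R) :
  (forall i, polyseq (f i)) -> polyseq (fun k => \sum_(i <- r) f i k).
Proof.
move=> fP; elim: r => [|i r IH].
  by exists 0 => k; rewrite big_nil horner0.
have [P hP] := polyseqD (fP i) IH; exists P => k.
by rewrite big_cons hP.
Qed.

Lemma polyseq_prod (I : Type) (r : seq I) (f : I -> nat -> R) :
  (forall i, polyseq (f i)) -> polyseq (fun k => \prod_(i <- r) f i k).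
Proof.
move=> fP; elim: r => [|i r IH].
  by exists 1 => k; rewrite big_nil hornerC.
have [P hP] := polyseqM (fP i) IH; exists P => k.
by rewrite big_cons hP.
Qed.

Lemma polyseqX s m : polyseq s -> polyseq (fun k => s k ^+ m).
Proof. by move=> [P sP]; exists (P ^+ m) => k; rewrite horner_exp sP. Qed.

Lemma polyseq_bin i : polyseq (fun k => 'C(k, i)%:R).
Proof.
elim: i => [|i [P hP]]; first by exists 1 => k; rewrite bin0 hornerC.
exists (P * ('X - i%:R%:P) * (i.+1%:R^-1)%:P) => k.
rewrite !hornerM hornerXsubC hornerC -hP.
apply: (mulIf (_ : i.+1%:R != 0)); first by rewrite pnatr_eq0.
rewrite mulfVK ?pnatr_eq0 // mulrC -natrM mul_bin_left natrM mulrC.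
have [ik|ki] := leqP i k; first by rewrite natrB.
by rewrite bin_small // !mul0r.
Qed.

Lemma polyseq_meval n (q : mpoly.mpoly n R) (x : nat -> 'I_n -> R) :
  (forall i, polyseq (x^~ i)) -> polyseq (fun k => mpoly.meval (x k) q).
Proof.
move=> xP.
have [P hP] := @polyseq_sum _ (mpoly.msupp q)
   (fun m k => mpoly.mcoeff m q * \prod_(i <- index_enum 'I_n) x k i ^+ mpoly.fun_of_multinom m i)
   (fun m => polyseqM (polyseq_cst _) (polyseq_prod _
     (fun i => polyseqX (mpoly.fun_of_multinom m i) (xP i)))).
by exists P => k; rewrite -hP mpoly.mevalE.
Qed.

Lemma size_poly_shift (P : {poly R}) : (size (P \Po ('X + 1) - P)%R <= (size P).-1)%N.
Proof.
elim/poly_ind: P => [|Q c IH]; first by rewrite comp_poly0 subr0 size_poly0.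
have -> : (Q * 'X + c%:P) \Po ('X + 1) - (Q * 'X + c%:P) =
    (Q \Po ('X + 1) - Q) * ('X + 1) + Q.
  by rewrite comp_polyD comp_polyM comp_polyC comp_polyX; ring.
rewrite size_MXaddC; case: ifP => [/andP[/eqP-> _]|_].
  by rewrite comp_poly0 subr0 mul0r addr0 size_poly0.
have [->|Q0] := eqVneq Q 0; first by rewrite comp_poly0 subr0 mul0r addr0 size_poly0.
apply: leq_trans (size_polyD _ _) _; rewrite geq_max leqnn andbT.
apply: leq_trans (size_polyMleq _ _) _.
rewrite -[1]/(1%:P) size_XaddC addn2 /=.
by apply: leq_ltn_trans IH _; rewrite prednK // size_poly_gt0.
Qed.

Section MatrixOrbit.
Variables (m : nat) (X : 'M[R]_m.+1).

Lemma nilpotent_orbit d (u : 'rV[R]_m.+1) j : u *m X ^+ d = 0 ->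
  polyseq (fun k => (u *m (1 + X) ^+ k) ord0 j).
Proof.
move=> ud.
have E k : u *m (1 + X) ^+ k = \sum_(i < d) 'C(k, i)%:R *: (u *m X ^+ i).
  case: d ud => [|d] ud.
    by rewrite big_ord0; move: ud; rewrite expr0 mulmx1 => ->; rewrite mul0mx.
  elim: k => [|k IH].
    rewrite expr0 mulmx1 big_ord_recl /= bin0 expr0 mulmx1 scale1r big1 ?addr0 //.
    by move=> i _; rewrite bin0n scale0r.
  rewrite exprSr mulmxA IH mulmxDr mulmx1 mulmx_suml.
  have -> : \sum_(i < d.+1) 'C(k, i)%:R *: (u *m X ^+ i) *m X =
            \sum_(i < d) 'C(k, i)%:R *: (u *m X ^+ i.+1).
    under eq_bigr do rewrite -scalemxAl -mulmxA -[_ *m X]exprSr.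
    by rewrite big_ord_recr /= ud scaler0 addr0.
  rewrite big_ord_recl [RHS]big_ord_recl /= !bin0 -addrA -big_split /=; congr (_ + _).
  by apply: eq_bigr => i _; rewrite -scalerDl -natrD addnC binS addnC.
have [P hP] := @polyseq_sum _ (index_enum 'I_d) (fun i k => 'C(k, i)%:R * (u *m X ^+ i) ord0 j)
  (fun i => polyseqM (polyseq_bin i) (polyseq_cst _)).
exists P => k; rewrite -hP E summxE; apply: eq_bigr => i _.
by rewrite mxE.
Qed.

(** Replacing [u] by [u *m X] takes the difference of the orbit sequence, which lowers its degree.
    Hence some power of [X] kills [u], and [expmx_kernel] adjusts the exponent. *)
Lemma orbit_nilpotent (u : 'rV[R]_m.+1) :
  (forall j, polyseq (fun k => (u *m (1 + X) ^+ k) ord0 j)) -> u *m X ^+ m.+1 = 0.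
Proof.
move=> /choice[P hP].
suff H D (v : 'rV[R]_m.+1) (Q : 'I_m.+1 -> {poly R}) : (forall j, (size (Q j) <= D)%N) ->
    (forall j k, (v *m (1 + X) ^+ k) ord0 j = (Q j).[k%:R]) -> v *m X ^+ D = 0.
  apply: (@expmx_kernel _ _ _ _ _ (\max_j size (P j))) => //.
  by apply: (H _ _ P) => // j; exact: (leq_bigmax j).
elim: D v Q => [|D IH] v Q sQ vQ.
  rewrite expr0 mulmx1; apply/rowP => j; have := vQ j 0%N.
  rewrite expr0 mulmx1 => ->; have := sQ j.
  by rewrite leqn0 size_poly_eq0 => /eqP->; rewrite horner0 mxE.
rewrite exprS mulmxA; apply: (IH _ (fun j => Q j \Po ('X + 1) - Q j)) => [j|j k].
  by apply: leq_trans (size_poly_shift _) _; rewrite -subn1 leq_subLR add1n.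
rewrite hornerD hornerN horner_comp hornerD hornerX hornerC natr1 -!vQ.
have -> : v *m X *m (1 + X) ^+ k = v *m (1 + X) ^+ k.+1 - v *m (1 + X) ^+ k.
  rewrite exprS -[(1 + X) * _]/((1 + X) *m _) mulmxDl mul1mx mulmxDr.
  by rewrite addrAC subrr add0r mulmxA.
by rewrite !mxE.
Qed.
End MatrixOrbit.
End PolynomialSequence.

(** * Affine maps in homogeneous coordinates *)

Section AffineMatrix.
Variables (R : realType) (n : nat).
Local Notation V := 'rV[R]_n.
Implicit Types (x y v w : V) (f g h : V -> V).

Definition hat x : 'rV[R]_(1 + n) := row_mx (1 : 'rV_1) x.

(** The entries are fixed combinations of the values of [h] at finitely many points, so they depend
    continuously on those values. Vectors being rows, composition reverses the order of products. *)
Definition affine_mx h : 'M[R]_(1 + n) :=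
  col_mx (hat (h 0)) (\matrix_i (hat (h (delta_mx ord0 i)) - hat (h 0))).

Lemma hat_comb (a b : R) x y : a + b = 1 ->
  hat (a *: x + b *: y) = a *: hat x + b *: hat y.
Proof.
move=> ab; rewrite /hat !scale_row_mx add_row_mx; congr row_mx.
by rewrite -scalerDl ab scale1r.
Qed.

Lemma hatB x y : hat x - hat y = row_mx 0 (x - y).
Proof. by rewrite /hat opp_row_mx add_row_mx subrr. Qed.

Lemma hat_inj : injective hat.
Proof. by move=> x y /eq_row_mx[]. Qed.

Lemma hatEr x i : hat x ord0 (rshift 1 i) = x ord0 i.
Proof. by rewrite /hat row_mxEr. Qed.

Lemma hatEl x : hat x ord0 (lshift n ord0) = 1.
Proof. by rewrite /hat row_mxEl mxE. Qed.

Lemma hat_affine_mx h x : affine_map h -> hat (h x) = hat x *m affine_mx h.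
Proof.
move=> [A [b hE]]; rewrite /affine_mx /hat mul_row_col -/(hat _) mul1mx.
have -> : \matrix_i (hat (h (delta_mx ord0 i)) - hat (h 0)) = row_mx 0 A .
  apply/row_matrixP => i; rewrite rowK hatB !hE mul0mx add0r addrK -rowE.
  by rewrite row_row_mx row0.
rewrite mul_mx_row mulmx0 /hat add_row_mx addr0; congr row_mx.
by rewrite !hE mul0mx add0r addrC.
Qed.

Lemma hat_span (k : nat) (X Y : 'M[R]_(1 + n, k)) :
  (forall x, hat x *m X = hat x *m Y) -> X = Y.
Proof.
move=> XY; apply/eqP; rewrite -subr_eq0; apply/eqP.
have {XY} Z x : hat x *m (X - Y) = 0 by rewrite mulmxBr XY subrr.
set W := X - Y in Z *.
rewrite -[W]vsubmxK; have := Z 0.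
rewrite -{1}[W]vsubmxK /hat mul_row_col mul1mx mul0mx addr0 => u0.
rewrite u0; suff -> : dsubmx W = 0 by exact: col_mx0.
apply/row_matrixP => i; have := Z (delta_mx ord0 i).
by rewrite -{1}[W]vsubmxK /hat mul_row_col mul1mx u0 add0r -rowE row0.
Qed.

Lemma affine_mxM f g : affine_map f -> affine_map g -> affine_map (f \o g) ->
  affine_mx (f \o g) = affine_mx g *m affine_mx f.
Proof.
move=> af ag afg; apply: hat_span => x.
by rewrite mulmxA -!hat_affine_mx.
Qed.

Lemma affine_id : affine_map (id : V -> V).
Proof. by exists 1%:M, 0 => x; rewrite mulmx1 addr0. Qed.

Lemma affine_mx1 : affine_mx id = 1.
Proof. by apply: hat_span => x; rewrite -hat_affine_mx ?mulmx1 //; exact: affine_id. Qed.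

Lemma affine_mx_eq1 h : affine_map h -> affine_mx h = 1 -> h =1 id.
Proof.
move=> ah h1 x; apply: hat_inj; rewrite hat_affine_mx // h1; exact: mulmx1.
Qed.

Lemma affine_iter (T : homeo V) k x : affine_map T ->
  hat (iter k T x) = hat x *m affine_mx T ^+ k.
Proof.
move=> aT; elim: k => [|k IH]; first by rewrite expr0 mulmx1.
by rewrite iterS hat_affine_mx // IH exprSr mulmxA.
Qed.

Lemma affine_mxB1_col0 h (u : 'rV[R]_(1 + n)) : affine_map h ->
  (u *m (affine_mx h - 1)) ord0 (lshift n ord0) = 0.
Proof.
move=> ah; suff -> : affine_mx h - 1 = row_mx 0 (rsubmx (affine_mx h - 1)).
  rewrite (mul_mx_row u) mulmx0.
  by rewrite row_mxEl mxE.
apply: hat_span => x; rewrite mulmxBr -hat_affine_mx // mulmx1 hatB mul_mx_row mulmx0.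
by rewrite mulmx_rsub mulmxBr -hat_affine_mx // mulmx1 hatB row_mxKr.
Qed.

Lemma hat_ex (u : 'rV[R]_(1 + n)) : u ord0 (lshift n ord0) = 1 -> exists x, u = hat x.
Proof.
move=> u1; exists (rsubmx u); rewrite /hat -[LHS]hsubmxK; congr row_mx.
by apply/rowP => i; rewrite (ord1 i) !mxE u1.
Qed.
End AffineMatrix.

Section Unipotent.
Variables (R : realType) (n : nat) (G : set (homeo 'rV[R]_n)).
Variables (M : topologicalType) (p : 'rV[R]_n -> M).
Local Notation V := 'rV[R]_n.
Hypothesis HM : compact_complete_polynomial_manifold G p.

(* The points with polynomial orbit under [T] form a nonempty affine subspace,
   which is [G]-invariant because the elements of [G] are polynomial. *)
Lemma affine_commuting_unipotent (T : homeo V) : affine_map T ->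
  (forall g, G g -> (T * g = g * T)%g) -> (affine_mx T - 1) ^+ n.+1 = 0.
Proof.
move=> aT Tc; set X := affine_mx T - 1.
have TX : affine_mx T = 1 + X by rewrite addrC subrK.
suff F v : hat v *m X ^+ n.+1 = 0 by apply: hat_span => x; rewrite F mulmx0.
move: v; apply: (@convex_invariant_full _ _ _ _ _ HM [set v | hat v *m X ^+ n.+1 = 0]).
- have [q qE] := expmx_stablen X; set Z := horner_mx X q in qE.
  have XZ : GRing.comm (X ^+ n.+1) (Z ^+ n.+1).
    apply: commrX; apply: commr_sym; apply: commrX.
    by rewrite -[X in GRing.comm _ X](horner_mx_X X); exact: comm_horner_mx2.
  (* The Fitting component of [hat 0] in the image of [X ^+ n.+1]. Its first coordinate is 0, so
     [hat 0 - w] is in the kernel and is still [hat] of a point. *)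
  pose w := hat 0 *m Z ^+ n.+1 *m X ^+ n.+1.
  have w0 : w ord0 (lshift n ord0) = 0.
    by rewrite /w (exprSr X) mulmxA; exact: affine_mxB1_col0.
  have [|v vE] := @hat_ex R n (hat 0 - w).
    by rewrite mxE [X in _ + X]mxE w0 subr0 hatEl.
  have ZXX : Z ^+ n.+1 * (X ^+ n.+1 * X ^+ n.+1) = X ^+ n.+1.
    by rewrite mulrA -XZ -mulrA -XZ mulrA -exprD -qE.
  have wE : w *m X ^+ n.+1 = hat 0 *m X ^+ n.+1.
    by rewrite /w -!mulmxA; exact: (congr1 (mulmx (hat 0)) ZXX).
  by exists v; rewrite /= -vE mulmxBl wE subrr.
- move=> x y t /andP[t0 t1] /= xF yF.
  have t1E : t + (1 - t) = 1 by rewrite addrC subrK.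
  by rewrite (hat_comb _ _ t1E) mulmxDl -!scalemxAl xF yF !scaler0 addr0.
- move=> g v Gg /= vF; apply: orbit_nilpotent => j; rewrite -TX.
  have gT k : g (iter k T v) = iter k T (g v).
    elim: k => //= k IH; rewrite -IH.
    by rewrite -[LHS]/((g * T)%g _) -Tc.
  have vk i : polyseq (fun k => iter k T v ord0 i).
    have [P hP] := nilpotent_orbit (rshift 1 i : 'I_n.+1) vF; exists P => k.
    by rewrite -hP -TX -affine_iter //; exact/esym/hatEr.
  have [P hP] : polyseq (fun k => hat (iter k T (g v)) ord0 j).
    case: (@splitP 1 n j) => i ji.
      exists 1 => k; rewrite hornerC.
      have -> : j = (lshift n ord0 : 'I_(1 + n)) by apply: ord_inj; rewrite ji (ord1 i).
      exact: hatEl.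
    have [q qE] := deck_poly HM Gg i.
    have [P hP] := polyseq_meval q vk; exists P => k.
    rewrite -hP -qE gT; have -> : j = (rshift 1 i : 'I_(1 + n)) by apply: ord_inj.
    exact: hatEr.
  by exists P => k; rewrite -hP affine_iter.
Qed.
End Unipotent.

(** * Lifts of homeomorphisms close to the identity *)

Lemma connected_locally_constant (T : topologicalType) (A : set T) (P : T -> Prop) :
  connected A -> (forall x, A x -> \forall y \near x, A y -> (P x <-> P y)) ->
  forall x y, A x -> A y -> P x -> P y.
Proof.
move=> cA loc x y Ax Ay Px.
suff : [set z | A z /\ P z] = A by move=> e; have : A y by []; rewrite -e => -[].
apply: cA; first by exists x.
- exists [set z | A z -> P z]°; first exact: open_interior.
  apply/seteqP; split=> z [Az]; last by move=> /nbhs_singleton h; split=> //; exact: h.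
  move=> Pz; split=> //; rewrite /interior /=.
  by apply: filterS (loc z Az) => w h Aw; apply/(h Aw).
- exists (~` [set z | A z -> ~ P z]°); first exact/open_closedC/open_interior.
  apply/seteqP; split=> z [Az].
    by move=> Pz; split=> // /nbhs_singleton /(_ Az).
  move=> nint; split=> //; apply: contrapT => nPz; apply: nint.
  rewrite /interior /=; apply: filterS (loc z Az) => w h Aw Pw.
  by apply: nPz; apply/(h Aw).
Qed.

Lemma star_connected (R : realType) n (A : set 'rV[R]_n) :
  A 0 -> (forall x (t : R), A x -> 0 <= t <= 1 -> A (t *: x)) -> connected A.
Proof.
move=> A0 star.
have -> : A = \bigcup_(x in A) ((fun t : R => t *: x) @` `[0, 1]%classic).
  apply/seteqP; split=> [x Ax|_ [x Ax [t t01 <-]]].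
    by exists x => //; exists 1; rewrite ?scale1r //= in_itv /= ler01 lexx.
  by apply: star; move: t01; rewrite /= in_itv.
apply: bigcup_connected.
  by exists 0 => x _; exists 0; rewrite ?scale0r //= in_itv /= ler01 lexx.
move=> x _; apply: connected_continuous_connected; first exact: segment_connected.
apply: continuous_subspaceT => t; apply: continuousZr_tmp; exact: cvg_id.
Qed.

Section Lifts.
Variables (R : realType) (n : nat) (G : set (homeo 'rV[R]_n)).
Variables (M : topologicalType) (p : 'rV[R]_n -> M).
Local Notation V := 'rV[R]_n.
Hypothesis HM : compact_complete_polynomial_manifold G p.
Implicit Types (g h fh : homeo V) (x y v w : V) (f u : homeo M).

Lemma is_liftE fh f v : is_lift p fh f -> p (fh v) = f (p v).
Proof. by move=> /(congr1 (@^~ v)). Qed.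

Lemma is_lift1 : is_lift p 1%g 1%g.
Proof. by []. Qed.

Lemma is_liftM fh f fh' f' : is_lift p fh f -> is_lift p fh' f' ->
  is_lift p (fh * fh')%g (f * f')%g.
Proof.
move=> l l'; apply/funext => v; apply: etrans (is_liftE (fh' v) l) _.
exact: (congr1 f (is_liftE v l')).
Qed.

Lemma is_liftV fh f : is_lift p fh f -> is_lift p (fh^-1)%g (f^-1)%g.
Proof.
move=> l; apply/funext => v; apply: (can_inj (homeoK f)).
apply: etrans (esym (is_liftE _ l)) _.
by rewrite homeoVK; apply/esym; exact: homeoVK.
Qed.

Lemma is_lift_deck g : G g -> is_lift p g 1%g.
Proof. by move=> Gg; apply/funext => v /=; rewrite (proj_deck HM). Qed.

Lemma is_lift_inj fh f f' : is_lift p fh f -> is_lift p fh f' -> f = f'.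
Proof.
move=> l l'; apply: homeoP => m; have [v <-] := proj_surj HM m.
by rewrite -(is_liftE _ l) -(is_liftE _ l').
Qed.

Lemma unique_lift (f1 f2 : V -> V) x0 : continuous f1 -> continuous f2 ->
  (forall x, p (f1 x) = p (f2 x)) -> f1 x0 = f2 x0 -> f1 =1 f2.
Proof.
move=> c1 c2 pf e x.
apply: (@connected_locally_constant V setT (fun x => f1 x = f2 x) _ _ x0 x) => //.
  by apply: star_connected.
move=> {}x _; have [g Gg gx] := (proj_fiber HM (f1 x) (f2 x)).1 (pf x).
have r0 := sep_radius_gt0 HM (f2 x).
have n1 : \forall y \near x, `|f2 x - g (f1 y)| < sep_radius HM (f2 x).
  have c : {for x, continuous (fun y => g (f1 y))}.
    by apply: (continuous_comp (c1 x)); exact: homeo_cts.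
  have := c _ (nbhsx_ballx (g (f1 x)) _ r0).
  by rewrite gx -ball_normE.
have n2 : \forall y \near x, `|f2 x - f2 y| < sep_radius HM (f2 x).
  by have := c2 x _ (nbhsx_ballx (f2 x) _ r0); rewrite -ball_normE.
apply: filterS2 n1 n2 => y y1 y2 _.
have [h Gh hy] := (proj_fiber HM (f1 y) (f2 y)).1 (pf y).
have gh : g = h by apply: (sep_radiusP (HM := HM) (x := f2 x) (v := f1 y)) => //; rewrite hy.
split=> e'; first by rewrite -hy -gh (deck_free HM Gg (deck1 HM) (v := f1 x)) // gx homeo1E.
rewrite -gx; have -> : g = 1%g by rewrite gh; apply: (deck_free HM Gh (deck1 HM) (v := f1 y)); rewrite hy -e'.
by [].
Qed.

Lemma lifts_differ_by_deck fh fh' f : is_lift p fh f -> is_lift p fh' f ->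
  exists2 g, G g & fh' = (g * fh)%g.
Proof.
move=> l l'; have [g Gg gE] : exists2 g, G g & g (fh 0) = fh' 0.
  by apply/(proj_fiber HM); rewrite (is_liftE _ l) (is_liftE _ l').
exists g => //; apply: homeoP; apply: (@unique_lift _ _ 0) => //; try exact: homeo_cts.
by move=> x; rewrite homeoME (proj_deck HM _ Gg) (is_liftE _ l) (is_liftE _ l').
Qed.

Lemma lift_conj_deck fh f g : is_lift p fh f -> G g -> G (fh * g / fh)%g.
Proof.
move=> l Gg; have l1 : is_lift p (fh * g / fh)%g 1%g.
  rewrite -(mulgV f) -[f in (f / f)%g]mulg1.
  by apply: is_liftM (is_liftV l); apply: is_liftM l (is_lift_deck Gg).
have [h Gh ->] := lifts_differ_by_deck is_lift1 l1.
by rewrite mulg1.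
Qed.

Lemma near1_compact_open (C O : set M) : compact C -> open O -> C `<=` O ->
  nbhs (1%g : homeo M) (fun f : homeo M => forall m, C m -> O (f m)).
Proof.
move=> cC oO CO.
have cf : continuous (@homeo_fun M : homeo M -> {compact-open, M -> M}).
  exact: initial_continuous.
have : nbhs (1%g : homeo M) (@homeo_fun M @^-1` [set g : M -> M | g @` C `<=` O]).
  apply: cf; apply: open_nbhs_nbhs; split; first exact: compact_open_open.
  by move=> _ [m Cm <-]; exact: CO.
by apply: filterS => f fCO m Cm; apply: fCO; exists m.
Qed.

Lemma near_translate (f0 : homeo M) (Q : homeo M -> Prop) :
  nbhs (1%g : homeo M) Q -> nbhs f0 (fun f => Q (f0^-1 * f)%g).
Proof.
move=> nQ; apply: (@homeo_mull_continuous M (f0^-1)%g f0).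
by rewrite mulVg.
Qed.

Lemma near1_proj_close (b d : R) : 0 < d -> nbhs (1%g : homeo M)
  (fun f : homeo M => forall v, `|v| <= b -> exists2 w, p w = f (p v) & `|v - w| < d).
Proof.
move=> d0.
have cK := @compact_cball R n 0 b.
pose P (f : homeo M) v := exists2 w, p w = f (p v) & `|v - w| < d.
have H := (compact_near_coveringP _).1 cK _ (nbhs (1%g : homeo M)) P (nbhs_filter _).
apply: filterS (H _) => [f hf v vb|v _]; first by apply: hf; rewrite /= sub0r normrN.
pose C := p @` [set w | `|v - w| <= d / 4].
pose O := p @` ball v (d / 2).
have nf : nbhs (1%g : homeo M) (fun f : homeo M => forall m, C m -> O (f m)).
  apply: near1_compact_open.
  - apply: continuous_compact; last exact: compact_cball.
    by apply: continuous_subspaceT; exact: (proj_cts HM).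
  - exact/(proj_open HM)/row_ball_open.
  - move=> _ [w vw <-]; exists w => //; rewrite -ball_normE /=; apply: le_lt_trans vw _.
    by lra.
exists ([set w | `|v - w| <= d / 4], [set f : homeo M | forall m, C m -> O (f m)]).
  split=> //=; apply/nbhs_ballP; exists (d / 4); first by rewrite /= divr_gt0.
  by rewrite -ball_normE => w /ltW.
case=> v' f /= [vv' hf]; have [w vw wE] : O (f (p v')) by apply: hf; exists v'.
exists w => //; rewrite -ball_normE /= in vw.
have -> : v' - w = (v - w) - (v - v') by rewrite opprB [RHS]addrC addrA subrK.
by apply: le_lt_trans (ler_normB _ _) _; lra.
Qed.

Lemma uniform_separation (b : R) : exists2 d : R, 0 < d & forall v w g, `|v| <= b ->
  G g -> `|v - w| <= d -> `|v - g w| <= d -> g = 1%g.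
Proof.
have cK := @compact_cball R n 0 b.
pose P (d : R) v := forall w g, G g -> `|v - w| <= d -> `|v - g w| <= d -> g = 1%g.
suff nd : \forall d \near (0 : R)^'+, [set y : V | `|0 - y| <= b] `<=` P d.
  have : \forall d \near (0 : R)^'+, 0 < d /\ [set y : V | `|0 - y| <= b] `<=` P d.
    by apply: filterS2 (nbhs_right_gt 0) nd.
  move=> /filter_ex[d [d0 hd]]; exists d => // v w g vb; apply: hd.
  by rewrite /= sub0r normrN.
apply: ((compact_near_coveringP _).1 cK _ (0 : R)^'+ P _) => v _.
have r0 := sep_radius_gt0 HM v; set r := sep_radius HM v in r0.
have r20 : 0 < r / 2 by rewrite divr_gt0.
exists (ball v (r / 2), [set d | d < r / 2]).
  split; first exact: nbhsx_ballx.
  exact: nbhs_right_lt.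
case=> v' d; rewrite -ball_normE /= => -[vv' dr] w g Gg w1 w2.
have close y : `|v' - y| <= d -> `|v - y| < r.
  move=> y1; have -> : v - y = (v - v') + (v' - y) by rewrite addrA subrK.
  by apply: le_lt_trans (ler_normD _ _) _; lra.
apply: (sep_radiusP (HM := HM) (x := v) (v := w) Gg (deck1 HM)); first exact: close.
by rewrite homeo1E; exact: close.
Qed.

(** The given lift is composed with a deck transformation so that it moves [0] little. On the ball
    its displacement never equals [d]: up to that value, [uniform_separation] identifies the lifted
    point with the point of its fibre close to [x]. By connectedness the displacement stays below
    [d]. *)
Lemma near_lift (b e : R) : 0 <= b -> 0 < e -> nbhs (1%g : homeo M)
  (fun f : homeo M => Aff p f -> exists fh, is_lift p fh f /\
     forall v, `|v| <= b -> `|v - fh v| < e).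
Proof.
move=> b0 e0; have [d1 d10 sep] := uniform_separation b.
pose d := Order.min (d1 / 2) e.
have d0 : 0 < d by rewrite lt_min divr_gt0.
apply: filterS (near1_proj_close b d0) => f close [fh lf _].
have [|w wE w0] := close 0; first by rewrite normr0.
have [g Gg gw] : exists2 g, G g & g (fh 0) = w.
  by apply/(proj_fiber HM); rewrite (is_liftE _ lf).
have lg : is_lift p (g * fh)%g f by rewrite -[f]mul1g; apply: is_liftM lf; exact: is_lift_deck.
exists (g * fh)%g; split=> // v vb; apply: (@lt_le_trans _ _ d); last by rewrite ge_min lexx orbT.
move: (g * fh)%g (homeoME g fh 0) lg => h; rewrite gw => h0 lh {g Gg gw fh lf}.
have cdist : continuous (fun x : V => `|x - h x|).
  move=> x; apply: (@continuous_comp V V R (fun x => x - h x) (fun x => `|x|)).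
    by apply: continuousB; [exact: cvg_id|exact: homeo_cts].
  exact: (@norm_continuous R 'rV[R]_n).
apply: (@connected_locally_constant V [set x | `|x| <= b] (fun x => `|x - h x| < d) _ _ 0 v) => //=.
- apply: star_connected; first by rewrite /= normr0.
  move=> x t /= xb /andP[t0 t1]; rewrite normrZ ger0_norm //; apply: le_trans xb.
  by rewrite ler_piMl.
- move=> x xb; have [xd|xd] := ltP `|x - h x| d.
    have nx : \forall y \near x, `|y - h y| < d := cdist x _ (lt_nbhsl xd).
    by apply: filterS nx => y yd _; split.
  have xd1 : d < `|x - h x|.
    rewrite ltNge; apply/negP => xd'.
    have [w' w'E xw'] := close x xb.
    have [g Gg gw'] : exists2 g, G g & g (h x) = w'.
      by apply/(proj_fiber HM); rewrite (is_liftE _ lh).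
    have dd1 : d <= d1 by rewrite ge_min; apply/orP; left; lra.
    have g1 : g = 1%g.
      apply: (sep x (h x)) => //; first exact: le_trans xd' dd1.
      by rewrite gw'; apply: ltW; apply: lt_le_trans xw' dd1.
    by move: gw' xw'; rewrite g1 homeo1E => <-; rewrite ltNge xd.
  have nx : \forall y \near x, d < `|y - h y| := cdist x _ (lt_nbhsr xd1).
  apply: filterS nx => y yd _; split=> //.
  by move=> yd'; have := lt_trans yd yd'; rewrite ltxx.
- by rewrite normr0.
- by rewrite h0.
Qed.

Definition central fh := forall g, G g -> (fh * g = g * fh)%g.

Lemma central1 : central 1%g.
Proof. by move=> g _; rewrite mulg1 mul1g. Qed.

Lemma centralM fh fh' : central fh -> central fh' -> central (fh * fh')%g.
Proof. by move=> c c' g Gg; rewrite -mulgA (c' g Gg) mulgA (c g Gg) mulgA. Qed.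

Lemma centralV fh : central fh -> central (fh^-1)%g.
Proof.
move=> c g Gg; apply: (mulgI fh); rewrite !mulgA (c g Gg).
by rewrite mulgV mul1g -mulgA mulgV mulg1.
Qed.

(* [V] being connected, [G] is generated by the finitely many elements that
   move some point of a large ball into that ball. *)
Lemma near_lift_central (b e : R) : 0 <= b -> 0 < e -> nbhs (1%g : homeo M)
  (fun f : homeo M => Aff p f -> exists fh, [/\ is_lift p fh f, central fh &
     forall v, `|v| <= b -> `|v - fh v| < e]).
Proof.
move=> b0 e0.
have [b1 [b10 b1P]] := bounded_domain HM.
have [s sP] := finite_meeting HM (@compact_cball R n 0 b1).
pose s' := [seq g <- s | `[< G g >]].
have s'G g : g \in s' -> G g by rewrite mem_filter => /andP[/asboolP].
have s'P g v : G g -> `|v| < b1 -> `|g v| < b1 -> g \in s'.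
  move=> Gg v1 gv1; rewrite mem_filter asboolT //=.
  by apply: (sP g v Gg); rewrite /= sub0r normrN ltW.
(* If [fh] moves points by less than [e1], then for [g] in [s'] both [g (fh 0)] and [fh (g 0)] are
   within the separating radius of [g 0]. *)
have [e1 [e10 e1P]] : exists e1 : R, 0 < e1 /\ forall g, g \in s' ->
    e1 <= sep_radius HM (g 0) /\ forall v, `|0 - v| < e1 -> `|g 0 - g v| < sep_radius HM (g 0).
  elim: (s') => [|g l [a [a0 IH]]]; first by exists 1.
  have : \forall v \near (0 : V), `|g 0 - g v| < sep_radius HM (g 0).
    have := homeo_cts (f := g) (nbhsx_ballx (g 0) _ (sep_radius_gt0 HM (g 0))).
    by rewrite -ball_normE.
  move=> /nbhs_ballP[c /= c0 hc].
  exists (Order.min a (Order.min c (sep_radius HM (g 0)))); split.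
    by rewrite !lt_min a0 c0 sep_radius_gt0.
  move=> h; rewrite inE => /predU1P[->|/IH[h1 h2]].
    split; first by rewrite !ge_min lexx !orbT.
    by move=> v; rewrite !lt_min => /and3P[_ vc _]; apply: hc; rewrite -ball_normE.
  split; first by rewrite ge_min h1.
  by move=> v; rewrite !lt_min => /andP[va _]; exact: h2.
pose b' := b + \sum_(g <- s') `|g 0|.
have sum0 : 0 <= \sum_(g <- s') `|g 0| by rewrite sumr_ge0.
have b'0 : 0 <= b' by rewrite addr_ge0.
have e'0 : 0 < Order.min e e1 by rewrite lt_min e0.
apply: filterS (near_lift b'0 e'0) => f hf /hf[fh [lf close]].
exists fh; split=> //; last first.
  move=> v vb; have : `|v| <= b' by rewrite (le_trans vb) // lerDl.
  by move=> /close; rewrite lt_min => /andP[].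
(* The conjugate of [g] by [fh] is a deck transformation sending [fh 0] to [fh (g 0)], while [g]
   sends it to [g (fh 0)]. Both images are close to [g 0], so the two coincide. *)
have s'c g : g \in s' -> (fh * g = g * fh)%g.
  move=> gs; have Gg := s'G _ gs; have [r1 r2] := e1P _ gs.
  have Gc := lift_conj_deck lf Gg.
  apply: (mulIg (fh^-1)%g); rewrite -[in RHS]mulgA mulgV mulg1.
  apply: (sep_radiusP (HM := HM) (x := g 0) (v := fh 0) Gc Gg).
    rewrite !homeoME homeoK; apply: lt_le_trans r1.
    have : `|g 0| <= b'.
      rewrite /b' (big_rem g) //= addrCA lerDl addr_ge0 // sumr_ge0 //.
    by move=> /close; rewrite lt_min => /andP[].
  apply: r2; have : `|0 : V| <= b' by rewrite normr0.
  by move=> /close; rewrite lt_min => /andP[].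
pose H g := G g /\ (fh * g = g * fh)%g.
have HV v : exists g, H g /\ `|g v| < b1.
  apply: (@connected_locally_constant V setT (fun v => exists g, H g /\ `|g v| < b1) _ _ 0 v) => //.
  - by apply: star_connected.
  - move=> x _; have op g : `|g x| < b1 -> \forall y \near x, `|g y| < b1.
      move=> gx; apply: (@continuous_comp V V R g (fun z => `|z|) x _ _ _ (lt_nbhsl gx)).
        exact: homeo_cts.
      exact: (@norm_continuous R 'rV[R]_n).
    have [g Gg gx] := b1P x.
    apply: filterS (op _ gx) => y gy _.
    have key h : H h -> (`|h x| < b1 \/ `|h y| < b1) -> H g.
      move=> [Gh hc] hxy; suff /s'c kc : (g / h)%g \in s'.
        split=> //; rewrite -[g](mulgVK h) mulgA kc -mulgA hc.
        by rewrite !mulgA.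
      case: hxy => h1; [apply: (s'P _ (h x))|apply: (s'P _ (h y))] => //;
       by [exact: (deck_div HM)|rewrite homeoME homeoK].
    split=> -[h [Hh h1]]; exists g; split=> //; apply: (key h) => //; by [left|right].
  - by exists 1%g; split; [split; [exact: (deck1 HM)|rewrite mulg1 mul1g]|rewrite homeo1E normr0].
move=> g Gg; have [h [[Gh hc] h1]] := HV ((g^-1)%g 0).
have /s'c kc : (h / g)%g \in s'.
  apply: (s'P _ 0); rewrite ?normr0 //; exact: (deck_div HM).
have -> : g = ((h / g)^-1 * h)%g by rewrite invgF mulgVK.
exact: (commuteM (commuteV kc) hc).
Qed.
End Lifts.

(** Two distinct values would put an interval of positive Lebesgue measure into the countable
    image. *)
Lemma countable_image_const (R : realType) (T : topologicalType) (A : set T) (f : T -> R) :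
  connected A -> {within A, continuous f} -> countable (f @` A) ->
  forall x y, A x -> A y -> f x = f y.
Proof.
move=> cA cf cfA; have cI : connected (f @` A) by exact: connected_continuous_connected.
have /connected_intervalP iI := cI.
suff lt x y : A x -> A y -> ~ f x < f y.
  move=> x y Ax Ay; apply/eqP; rewrite eq_le !leNgt.
  by apply/andP; split; apply/negP; apply: lt.
move=> Ax Ay fxy.
have sub : `[f x, f y]%classic `<=` f @` A.
  move=> z /=; rewrite in_itv /= => /andP[xz zy].
  by apply: (iI (f x) (f y)); [exists x|exists y|rewrite xz zy].
have := countable_lebesgue_measure0 (sub_countable (subset_card_le sub) cfA).
rewrite lebesgue_measure_itv /= lte_fin fxy -EFinD => /eqP.
by rewrite eqe subr_eq0 => /eqP e; rewrite e ltxx in fxy.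
Qed.

(** * Central lifts, continuity of conjugation and rigidity *)

Section CentralLifts.
Variables (R : realType) (n : nat) (G : set (homeo 'rV[R]_n)).
Variables (M : topologicalType) (p : 'rV[R]_n -> M).
Local Notation V := 'rV[R]_n.
Hypothesis HM : compact_complete_polynomial_manifold G p.
Implicit Types (g h fh a : homeo V) (x y v w : V) (f u : homeo M).

(** For the inverse, [w], the preimage of [v], must first be bounded. If [g w] is in the ball of
    radius [b1], centrality gives [g v = uh (g w)], which is within [b1 + 1]; so [g] lies in a
    finite list that depends on [b] but not on [u]. *)
Lemma near_lift_central_inv (b e : R) : 0 <= b -> 0 < e -> nbhs (1%g : homeo M)
  (fun u : homeo M => Aff p u -> exists uh, [/\ is_lift p uh u, central G uh &
     forall v, `|v| <= b -> `|v - uh v| < e /\ `|v - (uh^-1)%g v| < e]).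
Proof.
move=> b0 e0; have [b1 [b10 b1P]] := bounded_domain HM.
pose c := Order.max b (b1 + 1).
have [s sP] := finite_meeting HM (@compact_cball R n 0 c).
have [B hB] := @seq_compact_bound R n _ s (fun g : homeo V => (g^-1)%g @` [set y : V | `|0 - y| <= b1])
  (fun g => continuous_compact (continuous_subspaceT (@homeo_cts _ (g^-1)%g)) (@compact_cball R n 0 b1)).
pose b' := Order.max b (Order.max B b1).
have bb' : b <= b' by rewrite le_max lexx.
have Bb' : B <= b' by rewrite !le_max lexx orbT.
have b1b' : b1 <= b' by rewrite !le_max lexx !orbT.
have e'0 : 0 < Order.min e 1 by rewrite lt_min e0 ltr01.
apply: filterS (near_lift_central HM (le_trans b0 bb') e'0) => u hu /hu[uh [lu cu close]].
exists uh; split=> // v vb; split.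
  by have := close v (le_trans vb bb'); rewrite lt_min => /andP[].
set w := (uh^-1)%g v; have vE : v = uh w by rewrite /w homeoVK.
have [g Gg gw] := b1P w.
have gv : g v = uh (g w) by rewrite vE -[LHS]/((g * uh)%g w) -cu.
have gvc : `|g v| <= c.
  rewrite le_max; apply/orP; right; rewrite gv.
  have := close _ (le_trans (ltW gw) b1b'); rewrite lt_min => /andP[_ lt1].
  have -> : uh (g w) = g w - (g w - uh (g w)) by rewrite opprB [RHS]addrC subrK.
  by apply: le_trans (ler_normB _ _) _; rewrite lerD // ltW.
have gs : g \in s.
  by apply: (sP g v) => //=; rewrite sub0r normrN // le_max vb.
have wB : `|w| <= B.
  by apply: (hB g w gs); exists (g w); rewrite ?homeoK //= sub0r normrN ltW.
have := close w (le_trans wB Bb'); rewrite lt_min => /andP[we _].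
by rewrite distrC [X in `|_ - X|]vE.
Qed.

Local Notation A0 := (Aff0 p).

Lemma Aff0_1 : A0 1%g.
Proof. by have /subgroupP[] := subgroup_Aff0 p. Qed.

Lemma Aff0_div f u : A0 f -> A0 u -> A0 (f / u)%g.
Proof. by have /subgroupP[_ H] := subgroup_Aff0 p; apply: H. Qed.

Lemma Aff0V f : A0 f -> A0 (f^-1)%g.
Proof. by move=> Af; rewrite -div1g; apply: Aff0_div => //; exact: Aff0_1. Qed.

Lemma Aff0M f u : A0 f -> A0 u -> A0 (f * u)%g.
Proof. by move=> Af Au; rewrite -[u]invgK; apply: Aff0_div => //; exact: Aff0V. Qed.

Lemma Aff0_Aff f : A0 f -> Aff p f.
Proof. exact: connected_component_sub. Qed.

Definition central_lift f fh := is_lift p fh f /\ central G fh.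

Lemma Aff0_central_lift f : A0 f -> exists fh, central_lift f fh.
Proof.
move=> Af.
apply: (@connected_locally_constant _ A0 (fun f => exists fh, central_lift f fh) _ _ 1%g f) => //.
- exact: component_connected.
- move=> f0 Af0; have := near_translate f0 (near_lift_central_inv (lexx 0) ltr01).
  apply: filterS => u hu Au.
  have [|uh [lu cu _]] := hu; first by apply: Aff0_Aff; apply: Aff0M => //; exact: Aff0V.
  have uE : u = (f0 * (f0^-1 * u))%g by rewrite mulgA mulgV mul1g.
  split=> -[fh [lf cf]].
    exists (fh * uh)%g; split; last exact: centralM.
    by rewrite uE; exact: is_liftM.
  exists (fh / uh)%g; split; last exact: centralM cf (centralV cu).
  have -> : f0 = (u / (f0^-1 * u))%g by rewrite invgM invgK mulgA mulgV mul1g.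
  by apply: is_liftM => //; apply: (is_liftV).
- exact: Aff0_1.
- by exists 1%g; split; [exact: is_lift1|exact: central1].
Qed.

(** An arbitrary choice, with no continuity in [f]; only conjugates of central elements by it are
    well behaved. *)
Definition clift f := xget 1%g [set fh | central_lift f fh].

Lemma cliftP f : A0 f -> is_lift p (clift f) f.
Proof.
by move=> /Aff0_central_lift[fh H]; have [] := @xgetPex _ 1%g [set fh | central_lift f fh] (ex_intro _ fh H).
Qed.

Lemma clift_central f : A0 f -> central G (clift f).
Proof.
by move=> /Aff0_central_lift[fh H]; have [] := @xgetPex _ 1%g [set fh | central_lift f fh] (ex_intro _ fh H).
Qed.

Lemma conj_lift_indep f fh a : A0 f -> is_lift p fh f -> central G a ->
  (a ^ clift f = a ^ fh)%g.
Proof.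
move=> Af lf ca; have [z Gz ->] := lifts_differ_by_deck HM lf (cliftP Af).
rewrite conjgM; congr (_ ^ _)%g.
by rewrite conjgE ca // mulgA mulVg mul1g.
Qed.

(** Near [f0], [clift f] may be replaced by [clift f0 * uh], with [uh] and its inverse close to the
    identity on a large ball; the conjugate is then [phi ^ uh]. *)
Lemma conj_lift_continuous a w : central G a ->
  {within A0, continuous (fun f => (a ^ clift f)%g w)}.
Proof.
move=> ca; apply/subspace_continuousP => f0 Af0.
set x0 := clift f0; set phi := (a ^ x0)%g.
apply/(@cvgrPdist_lt R V) => e e0.
have e20 : 0 < e / 2 by rewrite divr_gt0.
have [d d0 hd] : exists2 d : R, 0 < d & forall y, `|w - y| < d -> `|phi w - phi y| < Order.min (e / 2) 1.
  have m0 : 0 < Order.min (e / 2) 1 by rewrite lt_min e20 ltr01.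
  have := homeo_cts (f := phi) (nbhsx_ballx (phi w) _ m0).
  rewrite -ball_normE => /nbhs_ballP[d /= d0 hd]; exists d => // y wy.
  by apply: hd; rewrite -ball_normE.
pose b := `|w| + `|phi w| + 1.
have b0 : 0 <= b by rewrite !addr_ge0.
have e'0 : 0 < Order.min d (e / 2) by rewrite lt_min d0.
suff : nbhs f0 (fun f : homeo M => A0 f -> `|phi w - (a ^ clift f)%g w| < e) by [].
have := near_translate f0 (near_lift_central_inv b0 e'0).
apply: filterS => f hu Af.
have [|uh [lu cu close]] := hu; first by apply: Aff0_Aff; apply: Aff0M => //; exact: Aff0V.
have lf : is_lift p (x0 * uh)%g f.
  have -> : f = (f0 * (f0^-1 * f))%g by rewrite mulgA mulgV mul1g.
  by apply: is_liftM => //; exact: cliftP.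
rewrite (conj_lift_indep Af lf ca) conjgM -/phi.
have -> : (phi ^ uh)%g w = (uh^-1)%g (phi (uh w)) by [].
have [|w1 _] := close w; first by rewrite /b -addrA lerDl addr_ge0.
have w1d : `|w - uh w| < d by move: w1; rewrite lt_min => /andP[].
have := hd _ w1d; rewrite lt_min => /andP[y1 y2].
have [|_ y3] := close (phi (uh w)).
  have -> : phi (uh w) = phi w - (phi w - phi (uh w)) by rewrite opprB [RHS]addrC subrK.
  apply: le_trans (ler_normB _ _) _; rewrite /b -addrA -[leLHS]add0r lerD // lerD //.
  exact: ltW.
have {}y3 : `|phi (uh w) - (uh^-1)%g (phi (uh w))| < e / 2 by move: y3; rewrite lt_min => /andP[].
set A := phi w in y1 *; set B := phi (uh w) in y1 y3 *; set C := (uh^-1)%g B in y3 *.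
have -> : A - C = (A - B) + (B - C) by rewrite addrA subrK.
by apply: le_lt_trans (ler_normD _ _) _; lra.
Qed.

Lemma affineM g h : affine_map g -> affine_map h -> affine_map (g * h)%g.
Proof.
move=> ag ah; rewrite -[h]invgK; apply: affine_map_div => //.
by rewrite -div1g; apply: affine_map_div => //; exact: affine_id.
Qed.

Lemma affineV g : affine_map g -> affine_map (g^-1)%g.
Proof. by move=> ag; rewrite -div1g; apply: affine_map_div => //; exact: affine_id. Qed.

Lemma lift_deck_affine f fh : Aff p f -> is_lift p fh f ->
  exists2 g, G g & affine_map (g^-1 * fh)%g.
Proof.
move=> [fa la aa] lf; have [g Gg ->] := lifts_differ_by_deck HM la lf.
by exists g => //; rewrite mulgA mulVg mul1g.
Qed.

Definition central_affine h := affine_map h /\ central G h.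

(* Every central lift is an element of the countable group [G] times an affine
   map, so [psi] has a countable image; but [Aff0 p] is connected. *)
Lemma rigidity (psi : homeo M -> R) : {within A0, continuous psi} ->
  (forall f f' h, A0 f -> A0 f' -> central_affine h -> clift f' = (clift f * h)%g ->
     psi f' = psi f) ->
  forall f, A0 f -> psi f = psi 1%g.
Proof.
move=> cpsi inv f Af.
apply: (countable_image_const (@component_connected _ _ _) cpsi _ Af Aff0_1).
pose gam f := xget 1%g [set g | G g /\ affine_map (g^-1 * clift f)%g].
have gamP f' : A0 f' -> G (gam f') /\ affine_map ((gam f')^-1 * clift f')%g.
  move=> Af'; have [g Gg ag] := lift_deck_affine (Aff0_Aff Af') (cliftP Af').
  exact: (@xgetPex _ 1%g [set g | G g /\ affine_map (g^-1 * clift f')%g] (ex_intro _ g (conj Gg ag))).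
(* One element of [Aff0 p] for each deck part [g]. Two elements with the same deck part have chosen
   lifts that differ by a central affine map, so [psi] agrees on them. *)
pose rep g := xget 1%g [set f' | A0 f' /\ gam f' = g].
have sub : psi @` A0 `<=` (psi \o rep) @` G.
  move=> _ [f' Af' <-]; have [Gg ag] := gamP _ Af'; exists (gam f') => //=.
  have [Ar gr] : A0 (rep (gam f')) /\ gam (rep (gam f')) = gam f'.
    exact: (@xgetPex _ 1%g [set f'' | A0 f'' /\ gam f'' = gam f'] (ex_intro _ f' (conj Af' erefl))).
  set r := rep (gam f') in Ar gr *.
  have [_ ar] := gamP _ Ar; rewrite gr in ar.
  apply: (inv f' r ((clift f')^-1 * clift r)%g) => //; last by rewrite mulgA mulgV mul1g.
  split; last by apply: centralM; [apply: centralV|]; exact: clift_central.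
  have -> : ((clift f')^-1 * clift r)%g =
      (((gam f')^-1 * clift f')^-1 * ((gam f')^-1 * clift r))%g.
    by rewrite invgM invgK -mulgA (mulgA (gam f')) mulgV mul1g.
  by apply: affineM => //; exact: affineV.
apply: sub_countable (subset_card_le sub) _.
apply: sub_countable (card_image_le _ _) _; exact: (countable_deck HM).
Qed.
End CentralLifts.

(** * Descent along the nilpotent filtration *)

Lemma continuous_sum_fun (R : realType) (T : topologicalType) (I : Type) (r : seq I)
    (f : I -> T -> R) : (forall i, continuous (f i)) ->
  continuous (fun x => \sum_(i <- r) f i x).
Proof.
move=> cf; elim: r => [|i r IH] x.
  by under eq_fun do rewrite big_nil; exact: cst_continuous.
under eq_fun do rewrite big_cons.
by apply: (@continuousD R R T (f i) (fun x => \sum_(i <- r) f i x)); [exact: cf|exact: IH].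
Qed.

Lemma mulmx_coord_continuous (R : realType) (T : topologicalType) k m l q
    (A : 'M[R]_(k, m)) (B : T -> 'M[R]_(m, l)) (C : 'M[R]_(l, q)) i j :
  (forall i j, continuous (fun x => B x i j)) ->
  continuous (fun x => (A *m B x *m C) i j).
Proof.
move=> cB.
have -> : (fun x => (A *m B x *m C) i j) = (fun x => \sum_(b <- index_enum 'I_l)
    (\sum_(a <- index_enum 'I_m) A i a * B x a b) * C b j).
  apply/funext => x; rewrite mxE; apply: eq_bigr => b _; congr (_ * _).
  by rewrite mxE.
apply: continuous_sum_fun => b x.
apply: (@continuousM R T); last exact: cst_continuous.
apply: continuous_sum_fun => a {}x.
by apply: (@continuousM R T); [exact: cst_continuous|exact: cB].
Qed.

Lemma sandwichD (A : pzRingType) (s a b t : A) :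
  s * (a + b) * t = s * a * t + s * b * t.
Proof. by rewrite mulrDr mulrDl. Qed.

Section Nilpotency.
Variables (R : realType) (n : nat) (G : set (homeo 'rV[R]_n)).
Variables (M : topologicalType) (p : 'rV[R]_n -> M).
Local Notation V := 'rV[R]_n.
Hypothesis HM : compact_complete_polynomial_manifold G p.
Implicit Types (g h k fh a : homeo V) (x y v w : V) (f u : homeo M).
Local Notation A0 := (Aff0 p).
Local Notation Mat := 'M[R]_(1 + n).
Local Notation hc := (central_affine G).
Local Notation lift := (lift G p).

Lemma central_affine1 : hc 1%g.
Proof. by split; [exact: affine_id|exact: central1]. Qed.

Lemma central_affineM h k : hc h -> hc k -> hc (h * k)%g.
Proof. by move=> [? ?] [? ?]; split; [exact: affineM|exact: centralM]. Qed.

Lemma central_affineV h : hc h -> hc (h^-1)%g.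
Proof. by move=> [? ?]; split; [exact: affineV|exact: centralV]. Qed.

Lemma affine_mx_mul g h : affine_map g -> affine_map h ->
  affine_mx (g * h)%g = affine_mx h *m affine_mx g.
Proof. by move=> ag ah; apply: affine_mxM => //; exact: affineM. Qed.

Lemma affine_mx_mulV h : affine_map h -> affine_mx h *m affine_mx (h^-1)%g = 1.
Proof.
move=> ah; rewrite -affine_mx_mul //; last exact: affineV.
by rewrite mulVg; exact: affine_mx1.
Qed.

Lemma affine_mx_mulVl h : affine_map h -> affine_mx (h^-1)%g *m affine_mx h = 1.
Proof. by move=> ah; have := affine_mx_mulV (affineV ah); rewrite invgK. Qed.

Definition nil_mx h : Mat := affine_mx h - 1.
Definition nil_prod (s : seq (homeo V)) : Mat := \prod_(h <- s) nil_mx h.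

Lemma nil_prod_cat s t : nil_prod (s ++ t) = nil_prod s * nil_prod t.
Proof. by rewrite /nil_prod big_cat. Qed.

Lemma nil_prod1 h : nil_prod [:: h] = nil_mx h.
Proof. by rewrite /nil_prod big_seq1. Qed.

Lemma nil_prod0 (s : seq (homeo V)) : (forall h, h \in s -> hc h) ->
  (n < size s)%N -> nil_prod s = 0.
Proof.
move=> hs ns.
suff H (t : seq (homeo V)) : (forall h, h \in t -> hc h) -> size t = n.+1 -> nil_prod t = 0.
  rewrite -(cat_take_drop n.+1 s) nil_prod_cat H ?mul0r //; last by rewrite size_take_min; apply/minn_idPl.
  by move=> h /mem_take /hs.
move=> ht st; rewrite /nil_prod /nil_mx -(big_map (fun h : homeo V => affine_mx h) predT (fun A : Mat => A - 1)).
apply: (@kolchin R n (fun A : 'M[R]_n.+1 => exists2 h, hc h & A = affine_mx h)).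
- move=> _ _ [h [ah ch] ->] [k [ak ck] ->]; exists (k * h)%g; first exact: central_affineM.
  by rewrite affine_mx_mul.
- move=> _ [h [ah ch] ->]; exists n.+1; exact: (affine_commuting_unipotent HM ah ch).
- by move=> _ /mapP[h /ht Hh ->]; exists h.
- by rewrite size_map.
Qed.

(* The filtration through which the commutators with [Aff0 p] descend. *)
Definition filt m h := hc h /\ forall s t : seq (homeo V),
  (forall k, k \in s -> hc k) -> (forall k, k \in t -> hc k) ->
  (m <= size s + size t)%N -> nil_prod s * nil_mx h * nil_prod t = 0.

Lemma filt_top h : hc h -> filt n h.
Proof.
move=> Hh; split=> // s t hs ht le.
rewrite -(nil_prod1 h) -!nil_prod_cat; apply: nil_prod0.
  by move=> k; rewrite !mem_cat inE => /orP[/orP[/hs|/eqP->]|/ht].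
by rewrite !size_cat /= addn1 addSn ltnS.
Qed.

Lemma filt0 h : filt 0 h -> h = 1%g.
Proof.
move=> [[ah _] H]; apply: homeoP; apply: affine_mx_eq1 => //.
have := H [::] [::]; rewrite /nil_prod !big_nil mul1r mulr1 /nil_mx.
by move=> /(_ (fun _ => ltac:(done)) (fun _ => ltac:(done)) isT) /eqP; rewrite subr_eq0 => /eqP.
Qed.

Lemma filt_one m : filt m 1%g.
Proof.
split=> [|s t _ _ _]; first exact: central_affine1.
by rewrite /nil_mx affine_mx1 subrr mulr0 mul0r.
Qed.

Lemma filtM m h k : filt m h -> filt m k -> filt m (h * k)%g.
Proof.
move=> [Hh fh] [Hk fk]; split=> [|s t hs ht le]; first exact: central_affineM.
have -> : nil_mx (h * k)%g = nil_mx h + nil_mx k + nil_mx k * nil_mx h.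
  rewrite /nil_mx affine_mx_mul; [|by case: Hh|by case: Hk].
  rewrite mulrBl mulrBr mulr1 mul1r [RHS]addrC addrA subrK addrA subrK.
  by [].
rewrite (sandwichD _ (nil_mx h + nil_mx k) (nil_mx k * nil_mx h)).
rewrite (sandwichD _ (nil_mx h) (nil_mx k)) fh // fk // !add0r.
rewrite -{1}(nil_prod1 k) !mulrA -nil_prod_cat fh //.
  by move=> g; rewrite mem_cat inE => /orP[/hs|/eqP->].
by rewrite size_cat addnAC (leq_trans le) // leq_addr.
Qed.

Lemma filtV m h : filt m h -> filt m (h^-1)%g.
Proof.
move=> [Hh fh]; split=> [|s t hs ht le]; first exact: central_affineV.
have -> : nil_mx (h^-1)%g = - (nil_mx h + nil_mx (h^-1)%g * nil_mx h).
  have e := affine_mx_mulVl Hh.1; rewrite -[_ *m _]/(_ * _) in e.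
  rewrite -[X in X + _]mul1r -mulrDl [1 + _]addrC {2}/nil_mx subrK.
  by rewrite /nil_mx mulrBr e mulr1 opprB.
rewrite mulrN mulNr (sandwichD _ (nil_mx h) (nil_mx (h^-1)%g * nil_mx h)) fh // add0r.
rewrite -{1}(nil_prod1 (h^-1)%g) !mulrA -nil_prod_cat fh ?oppr0 //.
  by move=> g; rewrite mem_cat inE => /orP[/hs|/eqP->]; [|exact: central_affineV Hh].
by rewrite size_cat addnAC (leq_trans le) // leq_addr.
Qed.
End Nilpotency.

Section Descent.
Variables (R : realType) (n : nat) (G : set (homeo 'rV[R]_n)).
Variables (M : topologicalType) (p : 'rV[R]_n -> M).
Local Notation V := 'rV[R]_n.
Hypothesis HM : compact_complete_polynomial_manifold G p.
Implicit Types (g h k fh a : homeo V) (x y v w : V) (f u : homeo M).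
Local Notation A0 := (Aff0 p).
Local Notation Mat := 'M[R]_(1 + n).
Local Notation hc := (central_affine G).
Local Notation clift := (clift G p).

Lemma conj_deck g z : G z -> central G g -> (g ^ z)%g = g.
Proof. by move=> Gz cg; rewrite conjgE cg // mulgA mulVg mul1g. Qed.

(** The lift is a deck transformation times an affine map, and the deck factor does not move central
    elements under conjugation. *)
Lemma conj_lift_affine f fh : Aff p f -> is_lift p fh f ->
  exists2 g : homeo V, affine_map g & forall h, central G h -> (h ^ fh = h ^ g)%g.
Proof.
move=> Af lf; have [z Gz ag] := lift_deck_affine HM Af lf.
exists (z^-1 * fh)%g => // h ch.
have fhE : fh = (z * (z^-1 * fh))%g by rewrite mulgA mulgV mul1g.
apply: etrans (congr1 (conjg h) fhE) _; apply: etrans (conjgM h z _) _.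
exact: (congr1 (fun k => k ^ (z^-1 * fh))%g (conj_deck Gz ch)).
Qed.

Lemma central_conj g h : central G g -> central G h -> central G (g ^ h)%g.
Proof.
by move=> cg ch; rewrite conjgE; apply: centralM; [exact: centralV|exact: centralM].
Qed.

Lemma central_affine_conj f fh h : Aff p f -> central_lift G p f fh -> hc h ->
  hc (h ^ fh)%g.
Proof.
move=> Af [lf cf] [ah ch]; split; last exact: central_conj.
have [g ag ->] := conj_lift_affine Af lf => //.
by rewrite conjgE; apply: affineM; [exact: affineV|exact: affineM].
Qed.

Lemma clift_central_lift f : A0 f -> central_lift G p f (clift f).
Proof. by move=> Af; split; [exact: (cliftP HM)|exact: (clift_central HM)]. Qed.

Lemma clift1_deck : G (clift 1%g).
Proof.
have [g Gg ->] := lifts_differ_by_deck HM (@is_lift1 _ _ _ p) (cliftP HM (@Aff0_1 _ _ _ p)).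
by rewrite mulg1.
Qed.

Lemma central_lift_comm f f' fh fh' : central_lift G p f fh -> central_lift G p f' fh' ->
  central_lift G p [~ f, f']%g [~ fh, fh']%g.
Proof.
have M1 g g' u u' : central_lift G p u g -> central_lift G p u' g' ->
    central_lift G p (u * u')%g (g * g')%g.
  by move=> [? ?] [? ?]; split; [exact: is_liftM|exact: centralM].
have V1 g u : central_lift G p u g -> central_lift G p (u^-1)%g (g^-1)%g.
  by move=> [? ?]; split; [exact: is_liftV|exact: centralV].
move=> l l'; rewrite !commgEl !conjgE.
by apply: (M1 _ _ _ _ (V1 _ _ l)); apply: (M1 _ _ _ _ (V1 _ _ l')); exact: M1.
Qed.

Lemma Aff0_comm f f' : A0 f -> A0 f' -> A0 [~ f, f']%g.
Proof.
move=> Af Af'; rewrite commgEl conjgE.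
by apply: Aff0M; [exact: Aff0V|apply: Aff0M; [exact: Aff0V|exact: Aff0M]].
Qed.

Lemma hat_continuous (T : topologicalType) (phi : T -> V) i j :
  continuous phi -> continuous (fun q => hat (phi q) i j).
Proof.
move=> cphi q; rewrite /hat (ord1 i).
case: (split_ordP j) => l ->.
  under eq_fun do rewrite row_mxEl; exact: cst_continuous.
under eq_fun do rewrite row_mxEr.
exact: (continuous_comp (cphi q) (@coord_continuous R 1 n ord0 l (phi q))).
Qed.

(** The failure to preserve affine combinations, in homogeneous coordinates: composing on the left
    with an affine map multiplies it by a matrix. *)
Definition defect (g : V -> V) (t : R) v w : 'rV[R]_(1 + n) :=
  hat (g (t *: v + (1 - t) *: w)) - (t *: hat (g v) + (1 - t) *: hat (g w)).

Lemma defect_affine_mul (h g : V -> V) t v w : affine_map h ->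
  defect (h \o g) t v w = defect g t v w *m affine_mx h.
Proof.
move=> ah; rewrite /defect /= !(hat_affine_mx _ ah) mulmxBl mulmxDl.
by rewrite -!scalemxAl.
Qed.

Lemma defect0_affine (g : V -> V) : (forall t v w, defect g t v w = 0) -> affine_map g.
Proof.
move=> d0.
have gc t v w : g (t *: v + (1 - t) *: w) = t *: g v + (1 - t) *: g w.
  apply: hat_inj; apply/eqP; rewrite hat_comb; last by rewrite addrC subrK.
  by rewrite -subr_eq0; apply/eqP; exact: d0.
pose l x := g x - g 0.
have l0 : l 0 = 0 by rewrite /l subrr.
have lc t v w : l (t *: v + (1 - t) *: w) = t *: l v + (1 - t) *: l w.
  rewrite /l gc !scalerBr addrACA -opprD; congr (_ - _).
  by rewrite -scalerDl addrC subrK scale1r.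
have lZ t x : l (t *: x) = t *: l x.
  by have := lc t x 0; rewrite scaler0 addr0 l0 scaler0 addr0.
have lD x y : l (x + y) = l x + l y.
  have h2 : 1 - 2^-1 = 2^-1 :> R by lra.
  have := lc 2^-1 (2 *: x) (2 *: y).
  by rewrite h2 !lZ !scalerA mulVf ?pnatr_eq0 // !scale1r.
exists (\matrix_i l (delta_mx ord0 i)), (g 0) => x.
apply/eqP; rewrite -subr_eq -/(l x) mulmx_sum_row; apply/eqP.
rewrite {1}[x]row_sum_delta (big_morph l lD l0); apply: eq_bigr => i _.
by rewrite lZ rowK.
Qed.
End Descent.

(** For [y] central affine and [a], [x] central lifts, the factor in front of [[~ a, x]] is a
    product of conjugates of [y] and its inverse by central lifts, hence again central affine. *)
Lemma commgMr_conj (gT : groupType) (a x y : gT) :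
  ([~ a, x * y] = ((y^-1) ^ a * y ^ [~ a, x]^-1) * [~ a, x])%g.
Proof.
rewrite !commgEl conjgM !conjgE !invgM !invgK !mulgA.
by rewrite ?(mulgVK, mulgK).
Qed.

(** * Commutators in [Aff0 p] and the lower central series *)

Section Final.
Variables (R : realType) (n : nat) (G : set (homeo 'rV[R]_n)).
Variables (M : topologicalType) (p : 'rV[R]_n -> M).
Local Notation V := 'rV[R]_n.
Hypothesis HM : compact_complete_polynomial_manifold G p.
Implicit Types (g h k fh a : homeo V) (x y v w : V) (f u : homeo M).
Local Notation A0 := (Aff0 p).
Local Notation Mat := 'M[R]_(1 + n).
Local Notation hc := (central_affine G).
Local Notation clift := (clift G p).

(** Downward induction on [size s] shows [D u *m nil_prod s = 0]. Changing the lift of [u] by a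
    central affine map turns [D u] into [D u + D u *m nil_mx h2]; the extra term has one more factor
    and vanishes by induction. So [rigidity] gives the value at [u = 1], where [D] is 0. *)
Lemma commutator_affine f f' : A0 f -> A0 f' -> affine_map [~ clift f, clift f']%g.
Proof.
move=> Af Af'; set a := clift f; have [la ca] := clift_central_lift HM Af; rewrite -/a in la ca.
apply: defect0_affine => t v w.
pose D u := defect [~ a, clift u]%g t v w.
rewrite -/(D f'); move: f' Af'.
have D1 : D 1%g = 0.
  have -> : D 1%g = defect (1 : homeo V)%g t v w.
    by rewrite /D commgEl (conj_deck (clift1_deck HM) ca) mulVg.
  by rewrite /defect !homeo1E hat_comb ?subrr // addrC subrK.
have cD j : {within A0, continuous (fun u => D u ord0 j)}.
  have cx x : {within A0, continuous (fun u => [~ a, clift u]%g x)}.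
    rewrite (_ : (fun u => _) = (a^-1)%g \o (fun u => (a ^ clift u)%g x)); last first.
      by apply/funext => u; rewrite commgEl.
    move=> u; apply: (@continuous_comp (subspace A0) V V (fun u => (a ^ clift u)%g x) (a^-1)%g u);
      last exact: homeo_cts.
    have H := conj_lift_continuous HM (w := x) ca; exact (H u).
  have ch x : {within A0, continuous (fun u => hat ([~ a, clift u]%g x) ord0 j)}.
    by apply: hat_continuous; exact: cx.
  rewrite (_ : (fun u => _) = (fun u => hat ([~ a, clift u]%g (t *: v + (1 - t) *: w)) ord0 j -
      (t * hat ([~ a, clift u]%g v) ord0 j + (1 - t) * hat ([~ a, clift u]%g w) ord0 j))); last first.
    by apply/funext => u; rewrite /D /defect !mxE.
  move=> u; apply: (@continuousB R R (subspace A0)); first exact: ch.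
  apply: (@continuousD R R (subspace A0)).
    by apply: (@continuousM R (subspace A0)); [exact: cst_continuous|exact: ch].
  by apply: (@continuousM R (subspace A0)); [exact: cst_continuous|exact: ch].
(* [l] bounds the number of factors still missing; [l = n.+1] with [s] empty is the claim. *)
suff H (l : nat) (s : seq (homeo V)) : (forall h, h \in s -> hc h) -> (n < l + size s)%N ->
    forall u, A0 u -> D u *m nil_prod s = 0.
  move=> f' Af'; have := H n.+1 [::] _ _ f' Af'.
  rewrite /nil_prod big_nil => <- //; first exact: esym (mulmx1 _).
  by rewrite addn0.
elim: l s => [|l IH] s hs ns u Au; first by rewrite (nil_prod0 HM hs ns) mulmx0.
apply/rowP => j; transitivity ((D 1%g *m nil_prod s) ord0 j); last by rewrite D1 mul0mx.
apply: (rigidity HM (psi := fun u => (D u *m nil_prod s) ord0 j) _ _ Au).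
  rewrite (_ : (fun u => _) = (fun u => (1%:M *m D u *m nil_prod s) ord0 j)); last first.
    by apply/funext => u'; rewrite mul1mx.
  by apply: mulmx_coord_continuous => i i'; rewrite (ord1 i); exact: cD.
move=> u1 u2 h Au1 Au2 Hh e; rewrite /D e.
set K := [~ a, clift u1]%g.
have lK : central_lift G p [~ f, u1]%g K.
  by apply: (central_lift_comm (conj la ca)); exact: clift_central_lift.
pose h2 := ((h^-1) ^ a * h ^ K^-1)%g.
have Hh2 : hc h2.
  apply: central_affineM.
    apply: (central_affine_conj HM (Aff0_Aff Af) (conj la ca)).
    exact: central_affineV.
  have lK' : central_lift G p ([~ f, u1]^-1)%g (K^-1)%g.
    by split; [apply: is_liftV; case: lK|apply: centralV; case: lK].
  by apply: (central_affine_conj HM _ lK' Hh); apply: Aff0_Aff; apply: Aff0V; exact: Aff0_comm.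
have -> : [~ a, (clift u1 * h)%g]%g = (h2 * K)%g by exact: commgMr_conj.
apply: (congr1 (fun A : 'rV[R]_(1 + n) => A ord0 j)).
apply: etrans (congr1 (fun A : 'rV[R]_(1 + n) => A *m nil_prod s) (defect_affine_mul K t v w Hh2.1)) _.
have -> : affine_mx h2 = 1 + nil_mx h2 by rewrite /nil_mx addrC subrK.
rewrite mulmxDr mulmx1 mulmxDl -mulmxA -(nil_prod1 h2) -[nil_prod _ *m nil_prod _]nil_prod_cat.
rewrite [X in _ + X](_ : _ = 0) ?addr0 //; apply: IH => //=; last by rewrite addnS -addSn.
by move=> g; rewrite inE => /predU1P[->|/hs].
Qed.

Lemma nil_mx_conj g k : affine_map g -> affine_map k ->
  nil_mx (k ^ g)%g = affine_mx g * nil_mx k * affine_mx (g^-1)%g.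
Proof.
move=> ag ak; rewrite /nil_mx conjgE.
rewrite affine_mx_mul; [|exact: affineV|exact: affineM].
rewrite affine_mx_mul // mulrBr mulr1 mulrBl.
by congr (_ - _); apply/esym; exact: affine_mx_mulV.
Qed.

(** On central elements, conjugation by [clift f] is conjugation by an affine [g]. Each factor of
    the outer products is such a conjugate of its image under [c], which preserves central affine
    maps, so the inner matrices of [g] cancel. *)
Lemma filt_conj m h f : A0 f -> filt G m h -> filt G m (h ^ clift f)%g.
Proof.
move=> Af [Hh Fh]; have lf := clift_central_lift HM Af.
have [g ag gE] := conj_lift_affine HM (Aff0_Aff Af) lf.1.
have lV : central_lift G p (f^-1)%g ((clift f)^-1)%g.
  by split; [apply: is_liftV; case: lf|apply: centralV; case: lf].
split=> [|s t hs ht le]; first exact: (central_affine_conj HM (Aff0_Aff Af) lf).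
pose c k := (k ^ (clift f)^-1)%g.
have Hc k : hc k -> hc (c k) by exact: (central_affine_conj HM (Aff0_Aff (Aff0V Af)) lV).
have cK k : hc k -> nil_mx k = affine_mx g * nil_mx (c k) * affine_mx (g^-1)%g.
  move=> /Hc Hck; rewrite -nil_mx_conj //; last by case: Hck.
  by rewrite -gE; [rewrite conjgKV|case: Hck].
have gV : affine_mx (g^-1)%g * affine_mx g = 1 := affine_mx_mulVl ag.
have gV' : affine_mx g * affine_mx (g^-1)%g = 1 := affine_mx_mulV ag.
have prodE (r : seq (homeo V)) : (forall k, k \in r -> hc k) ->
    nil_prod r = affine_mx g * nil_prod (map c r) * affine_mx (g^-1)%g.
  elim: r => [|k r IH] hr; first by rewrite /nil_prod !big_nil mulr1 gV'.
  rewrite -cat1s map_cat !nil_prod_cat /= !nil_prod1 cK; last by apply: hr; rewrite inE eqxx.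
  rewrite IH; last by move=> k' k'r; apply: hr; rewrite inE k'r orbT.
  by rewrite !mulrA -(mulrA _ (affine_mx (g^-1)%g) (affine_mx g)) gV mulr1.
rewrite (prodE s hs) (prodE t ht) gE; last by case: Hh.
rewrite nil_mx_conj //; last by case: Hh.
rewrite !mulrA -(mulrA _ (affine_mx (g^-1)%g) (affine_mx g)) gV mulr1.
rewrite -(mulrA _ (affine_mx (g^-1)%g) (affine_mx g)) gV mulr1.
rewrite -(mulrA (affine_mx g)) -(mulrA (affine_mx g)) Fh ?mulr0 ?mul0r ?size_map //.
- by move=> _ /mapP[k /hs Hk ->]; exact: Hc.
- by move=> _ /mapP[k /ht Hk ->]; exact: Hc.
Qed.

(** Between products with at least [m] factors in all, [nil_mx (h ^ clift u)] is constant in [u].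
    Conjugating by a central affine [k] adds terms with a further factor [nil_mx k] or
    [nil_mx (k^-1)], and those vanish in [filt m.+1]; then [rigidity] applies. *)
Lemma filt_comm m h f : A0 f -> filt G m.+1 h -> filt G m [~ h, clift f]%g.
Proof.
move=> Af Fh; have Hh := Fh.1.
have key (s t : seq (homeo V)) : (forall k, k \in s -> hc k) -> (forall k, k \in t -> hc k) ->
    (m <= size s + size t)%N ->
    nil_prod s * nil_mx (h ^ clift f)%g * nil_prod t = nil_prod s * nil_mx h * nil_prod t.
  move=> hs ht le; apply/matrixP => i j.
  (* [clift 1] is a deck transformation and fixes [h] under conjugation, so the right-hand side is
     the value at [u = 1]. *)
  rewrite -[in RHS](conj_deck (clift1_deck HM) Hh.2).
  apply: (rigidity HM (psi := fun u => (nil_prod s * nil_mx (h ^ clift u)%g * nil_prod t) i j) _ _ Af).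
    apply: mulmx_coord_continuous => k l.
    have cx x : {within A0, continuous (fun u => (h ^ clift u)%g x)}.
      exact: (conj_lift_continuous HM (w := x) Hh.2).
    have chat x (l' : 'I_(1 + n)) : {within A0, continuous (fun u => hat ((h ^ clift u)%g x) ord0 l')}.
      by apply: hat_continuous; exact: cx.
    case: (split_ordP k) => k' ->.
      rewrite (_ : (fun u => _) = (fun u => hat ((h ^ clift u)%g 0) ord0 l - (1 : Mat) (lshift n k') l)); last first.
        by apply/funext => u; rewrite /nil_mx /affine_mx [LHS]mxE col_mxEu (ord1 k') [X in _ + X]mxE.
      by move=> u; apply: (@continuousB R R (subspace A0)); [exact: chat|exact: cst_continuous].
    rewrite (_ : (fun u => _) = (fun u => hat ((h ^ clift u)%g (delta_mx ord0 k')) ord0 l -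
        hat ((h ^ clift u)%g 0) ord0 l - (1 : Mat) (rshift 1 k') l)); last first.
      apply/funext => u; rewrite /nil_mx /affine_mx [LHS]mxE col_mxEd [X in _ + X]mxE; congr (_ - _).
      by rewrite !mxE.
    move=> u; apply: (@continuousB R R (subspace A0)); last exact: cst_continuous.
    by apply: (@continuousB R R (subspace A0)); exact: chat.
  move=> u1 u2 k Au1 Au2 Hk ->.
  set b := (h ^ clift u1)%g; have Fb : filt G m.+1 b by exact: filt_conj.
  rewrite conjgM -/b nil_mx_conj; [|by case: Hk|by case: Fb.1].
  have -> : affine_mx k = 1 + nil_mx k by rewrite /nil_mx addrC subrK.
  have -> : affine_mx (k^-1)%g = 1 + nil_mx (k^-1)%g by rewrite /nil_mx addrC subrK.
  have HkV := central_affineV Hk.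
  have hsk : forall g, g \in s ++ [:: k] -> hc g.
    by move=> g; rewrite mem_cat inE => /orP[/hs|/eqP->].
  have htk : forall g, g \in (k^-1)%g :: t -> hc g.
    by move=> g; rewrite inE => /predU1P[->|/ht].
  congr (fun_of_matrix _ i j).
  rewrite mulrDl mul1r (mulrDr _ 1) mulr1 sandwichD.
  rewrite [X in X + _](sandwichD _ (nil_mx b) (nil_mx k * nil_mx b)).
  have z1 : nil_prod s * (nil_mx k * nil_mx b) * nil_prod t = 0.
    rewrite -{1}(nil_prod1 k) !mulrA -nil_prod_cat Fb.2 //.
    by rewrite size_cat /= addn1 addSn ltnS.
  have z2 : nil_prod s * (nil_mx b * nil_mx (k^-1)%g) * nil_prod t = 0.
    rewrite -{1}(nil_prod1 (k^-1)%g) -!mulrA -nil_prod_cat mulrA Fb.2 //.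
    by rewrite /= addnS ltnS.
  have z3 : nil_prod s * (nil_mx k * nil_mx b * nil_mx (k^-1)%g) * nil_prod t = 0.
    rewrite -{1}(nil_prod1 (k^-1)%g) -{1}(nil_prod1 k) !mulrA -nil_prod_cat -mulrA -nil_prod_cat Fb.2 //.
    by rewrite size_cat /= addn1 addSn ltnS addnS (leq_trans le).
  by rewrite z1 addr0 (mulrDl (nil_mx b)) (sandwichD _ (nil_mx b * _)) z2 z3 !addr0.
have Hb : hc (h ^ clift f)%g := (filt_conj Af Fh).1.
have HV := central_affineV Hh.
rewrite commgEl; split=> [|s t hs ht le]; first exact: central_affineM.
(* The last factor can only lengthen [t], so only the difference matters, and [key] makes it
   vanish. *)
have E : nil_mx (h^-1 * h ^ clift f)%g =
    (nil_mx (h ^ clift f)%g - nil_mx h) * (1 + nil_mx (h^-1)%g).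
  have -> : 1 + nil_mx (h^-1)%g = affine_mx (h^-1)%g by rewrite /nil_mx addrC subrK.
  rewrite {1}/nil_mx affine_mx_mul; [|by case: HV|by case: Hb].
  have -> : nil_mx (h ^ clift f)%g - nil_mx h = affine_mx (h ^ clift f)%g - affine_mx h.
    by rewrite /nil_mx opprB addrA subrK.
  rewrite mulrBl; congr (_ - _); apply/esym; apply: affine_mx_mulV; by case: Hh.
have z (r : seq (homeo V)) : (forall k, k \in r -> hc k) -> (m <= size s + size r)%N ->
    nil_prod s * (nil_mx (h ^ clift f)%g - nil_mx h) * nil_prod r = 0.
  by move=> hr lr; rewrite mulrBr mulrBl key // subrr.
rewrite E (mulrDr _ 1) mulr1 sandwichD z // add0r.
rewrite -(nil_prod1 (h^-1)%g) -!mulrA -nil_prod_cat mulrA z //.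
  by move=> k; rewrite inE => /predU1P[->|/ht].
by rewrite /= addnS (leq_trans le).
Qed.

Definition layer m : set (homeo M) :=
  [set f | A0 f /\ exists h, is_lift p h f /\ filt G m h].

Lemma layer_subgroup m : subgroup (layer m).
Proof.
apply/subgroupP; split.
  by split; [exact: Aff0_1|exists 1%g; split; [exact: is_lift1|exact: filt_one]].
move=> f f' [Af [h [lh Fh]]] [Af' [h' [lh' Fh']]]; split; first exact: Aff0_div.
exists (h / h')%g; split; first by apply: is_liftM => //; exact: is_liftV.
by apply: filtM => //; exact: filtV.
Qed.

Lemma layer_comm m f f' : layer m.+1 f -> A0 f' -> layer m [~ f, f']%g.
Proof.
move=> [Af [h [lh Fh]]] Af'; split; first exact: Aff0_comm.
exists [~ h, clift f']%g; split; last exact: filt_comm.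
have lf : central_lift G p f h by split=> //; exact: Fh.1.2.
by have [] := central_lift_comm lf (clift_central_lift HM Af').
Qed.

Lemma Aff0_comm_layer f f' : A0 f -> A0 f' -> layer n [~ f, f']%g.
Proof.
move=> Af Af'; split; first exact: Aff0_comm.
have [l c] := central_lift_comm (clift_central_lift HM Af) (clift_central_lift HM Af').
exists [~ clift f, clift f']%g; split=> //; apply: (filt_top HM).
by split=> //; exact: commutator_affine.
Qed.

Lemma layer0 : layer 0 `<=` [set 1%g].
Proof.
move=> f [_ [h [lh /filt0 h1]]]; rewrite h1 in lh.
exact: (is_lift_inj HM lh (@is_lift1 _ _ _ p)).
Qed.

Lemma generated_sub (H S : set (homeo M)) : subgroup H -> S `<=` H -> generated S `<=` H.
Proof. by move=> sH SH; apply: smallest_sub. Qed.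

(** First commutators enter at [layer n], since they have central affine lifts, and each further
    commutator lowers the index by one. This accounts for the shift and for the bound [n.+1] on the
    class. *)
Lemma lower_central_layer (m : nat) : (m <= n)%N -> lower_central A0 m.+1 `<=` layer (n - m).
Proof.
elim: m => [|m IH] mn.
  rewrite subn0; apply: generated_sub; first exact: layer_subgroup.
  by move=> _ [f Af [f' Af' <-]]; exact: Aff0_comm_layer.
apply: generated_sub; first exact: layer_subgroup.
move=> _ [f /(IH (ltnW mn)) Lf [f' Af' <-]]; apply: layer_comm => //.
by rewrite subnSK.
Qed.

Lemma Aff0_nilpotent : is_nilpotent A0.
Proof.
exists n.+1; apply/seteqP; split.
  by apply: subset_trans (lower_central_layer (leqnn n)) _; rewrite subnn; exact: layer0.
move=> _ ->; move=> H [sH _].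
by have [] := (subgroupP H).1 sH.
Qed.
End Final.

Theorem corollary3p5 (R : realType) (n : nat) (G : set (homeo 'rV[R]_n))
    (M : topologicalType) (p : 'rV[R]_n -> M)
    (HM : compact_complete_polynomial_manifold G p) :
  is_nilpotent (Aff0 p).
Proof. exact: Aff0_nilpotent HM. Qed.
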